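(* Let $d$ be a positive integer and let $(G_n)_{n\ge 1}$ be a sequence of finite abelian groups with $|G_n|\to\infty$ as $n\to\infty$. Let $C_n$ be a uniformly random element of $\mathrm{Mat}_d(G_n)$. Suppose that $(\mu_{C_n})_{n\ge1}$ converges weakly in probability. Then there exists $m\in\mathbb{N}^*$ such that $\rho_{G_n}\to\delta_m$ weakly. Conversely, if $m\in\mathbb{N}^*$ and $\rho_{G_n}\to\delta_m$ weakly, then $\mu_{C_n}\to\eta_m^{*d}$ weakly in probability.
   Context: $\mathbb{N}=\{1,2,3,\dots\}$ and $\mathbb{N}^*=\mathbb{N}\cup\{\infty\}$ is the one-point compactification of $\mathbb{N}$ (discrete topology on $\mathbb{N}$). Measures are Borel measures; $\delta_m$ is the Dirac mass at $m$. For a finite abelian group $G$ (written additively), a $G$-circulant matrix is a complex matrix $(A_{x,y})_{x,y\in G}$ of the form $A_{x,y}=a(x-y)$ for some function $a\colon G\to\mathbb{C}$. $\mathrm{Mat}_d(G)$ is the set of all $G$-circulant matrices with entries in $\{0,1\}$ and exactly $d$ ones in each row and column. This set is non-empty when $|G|\ge d$; $C_n$ is considered for those $n$ with $|G_n|\ge d$ (all sufficiently large $n$). For a square complex matrix $M$ of dimension $N$ with eigenvalues $\lambda_1(M),\dots,\lambda_N(M)$ (with algebraic multiplicity), $\mu_M=\frac1N\sum_{k=1}^N\delta_{\lambda_k(M)}$ is its empirical spectral distribution. If $M$ is random, $\mu_M$ is a random probability measure on $\mathbb{C}$. A sequence $(\mu_n)$ of random probability measures on $\mathbb{C}$ converges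 weakly in probability to a (deterministic) probability measure $\mu$ on $\mathbb{C}$ if $\int f\,d\mu_n\to\int f\,d\mu$ in probability for every bounded continuous $f\colon\mathbb{C}\to\mathbb{R}$; it converges weakly in probability if it does so to some such deterministic $\mu$. For a finite abelian group $G$, $\rho_G=\frac{1}{|G|}\sum_{x\in G}\delta_{\mathrm{ord}_G(x)}$, regarded as a probability measure on $\mathbb{N}^*$, where $\mathrm{ord}_G(x)$ is the order of $x$ in $G$. For $m\in\mathbb{N}$, $\eta_m=\frac1m\sum_{k=1}^m\delta_{e^{2\pi i k/m}}$ is the uniform distribution on the $m$-th roots of unity, and $\eta_\infty$ is the uniform distribution on the unit circle in $\mathbb{C}$. $\eta_m^{*d}$ is the $d$-fold (additive) convolution of $\eta_m$ with itself on $\mathbb{C}$, i.e. the law of a sum of $d$ independent random variables with law $\eta_m$. *)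

(* Defs.v *)
From HB Require Import structures.
From mathcomp Require Import all_boot all_order all_algebra all_fingroup.
From mathcomp Require Import finmap complex.
From mathcomp Require Import all_classical all_reals all_analysis.
From mathcomp Require Import measurable_realfun.
From mathcomp Require Import ring lra.

Set Implicit Arguments.
Unset Strict Implicit.
Unset Printing Implicit Defensive.

Import Order.TTheory GRing.Theory Num.Theory.
Import numFieldNormedType.Exports.

Local Open Scope classical_set_scope.
Local Open Scope ring_scope.

(* The regular module [R[i]^o] carries the topology of the norm of [R[i]];
   the bare type [R[i]] has no canonical topology. *)
Notation Cplane R := (R[i]^o)%type.

Notation borel T := (g_sigma_algebraType (@open T)).

Notation Npos := {k : nat | (0 < k)%N}.

(* [Some k] is the integer [k] and [None] is the point at infinity. *)
Notation Nstar := (one_point_compactification (discrete_topology Npos)).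

Section empirical.
Context d (T : measurableType d) (R : realType).
Local Open Scope ereal_scope.

Definition empirical (s : seq T) (s_neq0 : s != [::]) : set T -> \bar R :=
  fun A => ((size s)%:R^-1)%R%:E * \sum_(x <- s) \d_x A.

Variables (s : seq T) (s_neq0 : s != [::]).

Let empirical0 : empirical s_neq0 set0 = 0.
Proof. by rewrite /empirical big1 ?mule0// => x _; rewrite measure0. Qed.

Let empirical_ge0 A : 0 <= empirical s_neq0 A.
Proof.
by rewrite /empirical mule_ge0 ?lee_fin ?invr_ge0 ?ler0n// sume_ge0.
Qed.

Let empirical_sigma_additive : semi_sigma_additive (empirical s_neq0).
Proof.
case: s s_neq0 => [//|x0 s'] t_neq0 F mF tF mUF.
have r_ge0 : (0 <= (size (x0 :: s'))%:R^-1 :> R)%R by rewrite invr_ge0.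
have -> : empirical t_neq0 = mscale (NngNum r_ge0)
    (msum (fun k => \d_(nth x0 (x0 :: s') k)) (size (x0 :: s'))).
  by apply/funext => A; rewrite /empirical /mscale/= /msum (big_nth x0) big_mkord.
exact: measure_semi_sigma_additive.
Qed.

HB.instance Definition _ := isMeasure.Build _ _ _ (empirical s_neq0)
  empirical0 empirical_ge0 empirical_sigma_additive.

Let empirical_setT : empirical s_neq0 [set: T] = 1.
Proof.
rewrite /empirical (eq_bigr (fun=> 1)); last by move=> x _; rewrite diracT.
rewrite sumEFin big_const_seq count_predT iter_addr_0 -EFinM mulVf//.
by rewrite pnatr_eq0 size_eq0.
Qed.

HB.instance Definition _ := Measure_isProbability.Build _ _ _
  (empirical s_neq0) empirical_setT.

End empirical.
Arguments empirical {d T} R {s} s_neq0.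

Section order_law.
Context (R : realType) (G : finZmodType).

(* The group law of a finZmodType is its addition, so [#[x]%g] is the additive
   order of [x]. *)
Definition pos_order (x : G) : Npos :=
  exist (fun k => (0 < k)%N) #[x]%g (order_gt0 x).

Definition orders : seq (borel Nstar) := [seq Some (pos_order x) | x <- enum G].

Lemma card_finZmod_gt0 : (0 < #|G|)%N.
Proof. by apply/card_gt0P; exists 0. Qed.

Lemma orders_neq0 : orders != [::].
Proof. by rewrite -size_eq0 size_map -cardE -lt0n card_finZmod_gt0. Qed.

Definition order_law : probability (borel Nstar) R :=
  empirical R orders_neq0.

End order_law.

Section circulant_matrices.
Context (R : realType).

(* Rows and columns are indexed by the elements of [G] through [enum_rank]. *)
Definition circulant (G : finZmodType) (A : 'M[R[i]]_#|G|) : Prop :=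
  exists a : G -> R[i],
    forall x y : G, A (enum_rank x) (enum_rank y) = a (x - y).

Definition Mat (d : nat) (G : finZmodType) : set 'M[R[i]]_#|G| :=
  [set A | [/\ circulant A,
               (forall i j, A i j = 0 \/ A i j = 1),
               (forall i, #|[set j | A i j == 1]%SET| = d) &
               (forall j, #|[set i | A i j == 1]%SET| = d)]].

Arguments Mat d G : clear implicits.

Lemma finite_Mat d G : finite_set (Mat d G).
Proof.
apply: (@sub_finite_set _ _
  [set map_mx (fun b : bool => b%:R) B | B in [set: 'M[bool]_#|G|]]).
  move=> A [_ A01 _ _]; exists (map_mx (fun z => z == 1) A) => //.
  apply/matrixP => i j; rewrite !mxE.
  by case: (A01 i j) => ->; rewrite ?eqxx// eq_sym oner_eq0.
exact/finite_image/finite_finset.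
Qed.

End circulant_matrices.
Arguments Mat R d G : clear implicits.

Section spectral_distribution.
Context (R : realType) (N : nat).
Implicit Types M : 'M[R[i]]_N.

(* The roots of the characteristic polynomial, listed with multiplicity. *)
Definition eigenvalues M : seq (borel (Cplane R)) :=
  sval (closed_field_poly_normal (char_poly M)).

Lemma char_poly_eigenvalues M :
  char_poly M = \prod_(z <- eigenvalues M) ('X - (z : R[i])%:P).
Proof.
rewrite /eigenvalues; case: closed_field_poly_normal => s /= {1}->.
by rewrite (monicP (char_poly_monic M)) scale1r.
Qed.

Lemma size_eigenvalues M : size (eigenvalues M) = N.
Proof.
apply: succn_inj; rewrite -[RHS](size_char_poly M) char_poly_eigenvalues.
by rewrite size_prod_XsubC.
Qed.

Hypothesis N_gt0 : (0 < N)%N.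

Lemma eigenvalues_neq0 M : eigenvalues M != [::].
Proof. by rewrite -size_eq0 size_eigenvalues -lt0n. Qed.

Definition esd M : probability (borel (Cplane R)) R :=
  empirical R (eigenvalues_neq0 M).

End spectral_distribution.

Section borel_complex.
Context (R : realType).
Local Notation C := (Cplane R).

Let normcRe (z : C) : `|z| = (Num.sqrt (complex.Re z ^+ 2 + complex.Im z ^+ 2))%:C%C.
Proof. exact: normc_def. Qed.

Lemma Re_continuous : continuous (@complex.Re R : C -> R).
Proof.
move=> z A /nbhs_ballP[e /= e0 eA]; apply/(@nbhs_ballP _ C).
exists e%:C%C => /=; first by rewrite ltcR.
move=> w zw; apply: eA; rewrite /ball/= -ltcR; apply: le_lt_trans zw.
rewrite normcRe lecR -raddfB -sqrtr_sqr ler_wsqrtr//.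
by rewrite lerDl sqr_ge0.
Qed.

Lemma Im_continuous : continuous (@complex.Im R : C -> R).
Proof.
move=> z A /nbhs_ballP[e /= e0 eA]; apply/(@nbhs_ballP _ C).
exists e%:C%C => /=; first by rewrite ltcR.
move=> w zw; apply: eA; rewrite /ball/= -ltcR; apply: le_lt_trans zw.
rewrite normcRe lecR -raddfB -sqrtr_sqr ler_wsqrtr//.
by rewrite lerDr sqr_ge0.
Qed.

Lemma continuous_borel_measurable (g : C -> R) :
  continuous g -> measurable_fun setT (g : borel C -> R).
Proof.
move=> /continuousP cg; apply: (measurability _ (RGenOpens.measurableE R)).
move=> _ [_ [a [b ->] <-]]; rewrite setTI; apply: sub_sigma_algebra; exact/cg/interval_open.
Qed.

Lemma norm_le_ReIm (z : C) :
  `|z| <= (`|complex.Re z| + `|complex.Im z|)%:C%C.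
Proof.
rewrite normcRe lecR -[leRHS]ger0_norm ?addr_ge0// -sqrtr_sqr ler_wsqrtr//.
rewrite sqrrD !real_normK ?num_real// lerD2r lerDl.
by rewrite mulrn_wge0// mulr_ge0.
Qed.

Lemma measurable_ReIm d (T : measurableType d) (f : T -> borel C) :
  measurable_fun setT (fun x => complex.Re (f x)) ->
  measurable_fun setT (fun x => complex.Im (f x)) ->
  measurable_fun setT f.
Proof.
move=> mRe mIm; apply: (@measurability _ _ _ (borel C) _ _ (@open C)) => //.
move=> _ [U oU <-]; rewrite setTI.
pose box (q : rat * rat * nat) : set C := [set z |
  `|complex.Re z - ratr q.1.1| < q.2.+1%:R^-1 :> R /\
  `|complex.Im z - ratr q.1.2| < q.2.+1%:R^-1 :> R].
have band_measurable (g : T -> R) (t u : R) : measurable_fun setT g ->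
    measurable [set x | `|g x - t| < u].
  move=> mg; have mgt : measurable_fun setT (fun x => `|g x - t| < u).
    apply: measurable_fun_ltr => //; apply: measurableT_comp => //.
    exact: measurable_funB.
  by have := mgt measurableT [set true]; rewrite setTI; apply.
have box_measurable q : measurable (f @^-1` box q).
  by apply: measurableI; exact: band_measurable.
have -> : f @^-1` U = \bigcup_(q in [set q | box q `<=` U]) (f @^-1` box q).
  apply/seteqP; split=> [x /= Ufx|x [q /= qU] /qU//].
  have /nbhs_ballP[e /= e0 eU] : nbhs (f x : C) U by exact: open_nbhs_nbhs.
  have [r er] : exists r : R, e = r%:C%C.
    by apply/complex_realP; rewrite gtr0_real.
  have r0 : 0 < r by rewrite er ltcR in e0.
  pose k := Num.truncn (r / 4)^-1.
  have kr : k.+1%:R^-1 < r / 4.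
    by rewrite invf_plt ?posrE ?divr_gt0// truncnS_gt.
  have near_rat (t : R) : exists q : rat, `|t - ratr q| < k.+1%:R^-1.
    have [q] : exists q, ratr q \in `]t - k.+1%:R^-1, t + k.+1%:R^-1[.
      by apply: rat_in_itvoo; rewrite ltrBlDr -addrA ltrDl addr_gt0// invr_gt0.
    rewrite in_itv/= => q_in; exists q.
    by rewrite distrC ltr_distl.
  have [q1 q1P] := near_rat (complex.Re (f x)).
  have [q2 q2P] := near_rat (complex.Im (f x)).
  exists (q1, q2, k) => //= z [/= z1 z2]; apply: eU.
  rewrite /ball/= er; apply: le_lt_trans (norm_le_ReIm _) _.
  rewrite ltcR !raddfB/=.
  have h (a b c : R) : `|a - c| < k.+1%:R^-1 -> `|b - c| < k.+1%:R^-1 ->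
      `|a - b| < r / 4 + r / 4.
    move=> h1 h2; rewrite (_ : a - b = (a - c) - (b - c)); last by ring.
    apply: le_lt_trans (ler_normB _ _) _.
    by rewrite ltrD// (lt_trans _ kr).
  rewrite (_ : r = (r / 4 + r / 4) + (r / 4 + r / 4)); last by field.
  by rewrite ltrD//; [exact: h q1P z1|exact: h q2P z2].
rewrite bigcup_mkcond; apply: countable_bigcupT_measurable => // q.
by case: ifPn.
Qed.

Definition expi (t : measurableTypeR R) : borel C := (cos t +i* sin t)%C.

Lemma measurable_expi : measurable_fun setT expi.
Proof.
apply: measurable_ReIm; apply: continuous_measurable_fun.
  exact: continuous_cos.
exact: continuous_sin.
Qed.

HB.instance Definition _ := isMeasurableFun.Build _ _ _ _ expi measurable_expi.

Definition add_borel (z : borel C * borel C) : borel C := (z.1 : C) + (z.2 : C).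

Lemma measurable_add_borel : measurable_fun setT add_borel.
Proof.
have mRe := continuous_borel_measurable Re_continuous.
have mIm := continuous_borel_measurable Im_continuous.
apply: measurable_ReIm.
  rewrite (_ : (fun z => _) = (fun z : borel C * borel C =>
    complex.Re z.1 + complex.Re z.2)); last by apply/funext => z; rewrite raddfD.
  by apply: measurable_funD; apply: measurableT_comp.
rewrite (_ : (fun z => _) = (fun z : borel C * borel C =>
  complex.Im z.1 + complex.Im z.2)); last by apply/funext => z; rewrite raddfD.
by apply: measurable_funD; apply: measurableT_comp.
Qed.

HB.instance Definition _ :=
  isMeasurableFun.Build _ _ _ _ add_borel measurable_add_borel.

End borel_complex.

Section limit_laws.
Context (R : realType).

Definition unity_roots (k : Npos) : seq (borel (Cplane R)) :=
  [seq expi (2 * pi * j%:R / (val k)%:R) | j <- iota 1 (val k)].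

Lemma unity_roots_neq0 k : unity_roots k != [::].
Proof. by rewrite -size_eq0 size_map size_iota -lt0n (valP k). Qed.

Lemma twopi_gt0 : 0 < 2 * pi :> R.
Proof. by rewrite mulr_gt0// pi_gt0. Qed.

Definition unity_law (m : Nstar) : probability (borel (Cplane R)) R :=
  match m with
  | Some k => empirical R (unity_roots_neq0 k)
  | None => distribution (uniform_prob twopi_gt0) (@expi R)
  end.

Definition convolution (mu nu : probability (borel (Cplane R)) R) :
    probability (borel (Cplane R)) R :=
  distribution (mu \x nu)%E (@add_borel R).

(* [d]-fold convolution, starting from the unit [dirac 0]. *)
Definition convolution_pow (mu : probability (borel (Cplane R)) R) (d : nat) :
    probability (borel (Cplane R)) R :=
  iter d (convolution mu) (dirac ((0 : Cplane R) : borel (Cplane R))).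

End limit_laws.
Arguments unity_law R m : clear implicits.

Section convergence.
Context (R : realType).

Definition weak_cvg (T : ptopologicalType)
    (mu_ : nat -> probability (borel T) R) (mu : probability (borel T) R) :=
  forall f : T -> R, continuous f -> bounded_fun f ->
    (\int[mu_ n]_z f z)%R @[n --> \oo] --> (\int[mu]_z f z)%R.

Context (disp : nat -> measure_display)
  (Omega : forall n, measurableType (disp n))
  (P : forall n, probability (Omega n) R).

Definition cvg_in_probability (X : forall n, Omega n -> R) (l : R) :=
  forall eps : R, 0 < eps ->
    P n [set w | eps < `|X n w - l|] @[n --> \oo] --> (0 : \bar R).

Definition weak_cvg_in_probability (T : ptopologicalType)
    (mu_ : forall n, Omega n -> probability (borel T) R)
    (mu : probability (borel T) R) :=
  forall f : T -> R, continuous f -> bounded_fun f ->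
    cvg_in_probability (fun n w => \int[mu_ n w]_z f z) (\int[mu]_z f z).

End convergence.

(* Meant for finite [S], such as [Mat R d G] (see [finite_Mat]): [fset_set S] is
   empty when [S] is infinite. *)
Definition uniformly_distributed (R : realType) (d : measure_display)
    (Omega : measurableType d) (P : probability Omega R)
    (T : choiceType) (S : set T) (X : Omega -> T) :=
  (forall w, S (X w)) /\
  (forall A, S A -> measurable (X @^-1` [set A]) /\
     P (X @^-1` [set A]) = ((#|` fset_set S|%:R)^-1)%:E).

(* Main.v *)
Require Import Defs.
From HB Require Import structures.
From mathcomp Require Import all_boot all_order all_algebra all_fingroup cyclic spectral.
From mathcomp Require Import finmap complex.
From mathcomp Require Import all_classical all_reals all_analysis.
From mathcomp Require Import measurable_realfun.
From mathcomp Require Import zify ring lra.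

Set Implicit Arguments.
Unset Strict Implicit.
Unset Printing Implicit Defensive.

Import Order.TTheory GRing.Theory Num.Theory.
Import numFieldNormedType.Exports.

Local Open Scope ring_scope.

(** Let [x_1, ..., x_d] be distinct elements of a finite abelian group [G] and
    [A] the circulant matrix of their indicator function. [A] is a sum of [d]
    commuting translation matrices, hence normal, and its spectral moment of
    order [(a, b)] (the mean of [lambda ^ a * conj lambda ^ b] over the spectrum)
    is the normalised trace of the product of the [a]-th power of [A] and the
    [b]-th power of its adjoint. Expanding the product, this moment is an integer:
    the number of pairs of words [(i_1 ... i_a, j_1 ... j_b)] such that
    [x_{i_1} + ... + x_{i_a} = x_{j_1} + ... + x_{j_b}] ([circmx_moment]). The
    theorem is thus a statement on additive coincidences among random elements
    of [G]; as almost all tuples are injective in a large group, these elements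
    may be taken independent and uniform ([prob_cvg0P]).

    The two words have the same sum when [c_1 x_1 + ... + c_d x_d = 0], with [c]
    the difference of their letter counts. The proportion of solutions of such an
    equation is at most the proportion of [c_k]-torsion elements of [G], for every
    [k] ([card_lin_ker_coord]). Weak convergence of the order laws to the Dirac
    mass at [m] means that the proportion of [n]-torsion elements tends to 0,
    unless [m] divides [n] and then all elements are eventually [n]-torsion
    ([order_limit], with the lemmas [order_limit_of_weak_cvg] and
    [weak_cvg_of_order_limit]).

    Converse half ([spectral_limit_of_order_limit]). With probability tending to
    1 the coincidences are exactly the pairs of words with letter counts congruent
    modulo [m]. Their number is the moment of order [(a, b)] of the [d]-fold
    convolution of the uniform law on the [m]-th roots of unity
    ([sum_ffun_unity_roots]). For infinite [m], polynomials of degree less than [M]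
    have the same integral against the convolution powers of the uniform laws on
    the circle and on the [M]-th roots of unity, so finite sums are enough there
    too ([unity_law_infinite_mean], [Rintegral_convolution_pow]). All the laws
    live on a fixed square, where the Weierstrass theorem ([zpoly_approx]) passes
    from moments to continuous test functions.

    Direct half ([order_limit_of_spectral_limit]). The number of zero-sum words of
    length [k] is an integer that converges in probability to a constant, so it
    is equal to a constant [c] with probability tending to 1. It is positive on
    tuples of [k]-torsion elements, so if [c = 0] the proportion [p] of [k]-torsion
    tends to 0. If [c > 0], comparing the mean of the count over all tuples with
    its mean over tuples of [k]-torsion elements shows that [p] is eventually
    larger than 1/2 ([tors_full_of_coinc]); since [1 / p] is an integer, [p = 1].
    The limit order [m] is the least [k] that eventually annihilates the groups,
    infinite if there is none. *)


(** * Solutions of linear equations in a finite abelian group *)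

(* Tuples of group elements form a finite abelian group, to which Lagrange's
   theorem and the product formula for subgroups apply. *)
HB.instance Definition _ (I : finType) (G : finZmodType) :=
  GRing.Zmodule.on {ffun I -> G}.

Section subgroups.

Lemma zmod_closed_group_set (V : finZmodType) (P : {pred V}) :
  GRing.zmod_closed P -> group_set [set x in P].
Proof.
move=> [P0 PB]; have PN x : x \in P -> - x \in P.
  by move=> Px; rewrite -sub0r PB.
apply/group_setP; split=> [|x y]; first by rewrite inE.
by rewrite !inE => Px Py; rewrite -[y]opprK PB// PN.
Qed.

(** The sum of the subgroups [P] and [Q] has cardinal [#|P| * #|Q|] divided by
    that of their intersection, so [P] is at least as dense in [Q] as in the whole
    group. All the density estimates below are instances. *)
Lemma leq_card_predI (V : finZmodType) (P Q : {pred V}) :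
  GRing.zmod_closed P -> GRing.zmod_closed Q ->
  (#|P| * #|Q| <= #|V| * #|[predI P & Q]|)%N.
Proof.
move=> /zmod_closed_group_set gP /zmod_closed_group_set gQ.
rewrite -(cardsE P) -(cardsE Q) -(cardsE [predI P & Q]).
rewrite (_ : [set x in [predI P & Q]] = [set x in P] :&: [set x in Q]); last first.
  by apply/setP => x; rewrite !inE.
rewrite -[X in (X * _ <= _)%N]/(#|Group gP|) -[X in (_ * X <= _)%N]/(#|Group gQ|).
by rewrite mul_cardG leq_mul2r max_card orbT.
Qed.

End subgroups.

Section torsion.
Variable G : finZmodType.

Definition tors (n : nat) : {pred G} := [pred x | x *+ n == 0].

Lemma tors_zmod_closed n : GRing.zmod_closed (tors n).
Proof.
split=> [|x y]; rewrite !inE ?mul0rn// => /eqP xn /eqP yn.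
by rewrite mulrnBl xn yn subr0.
Qed.

Lemma mulrz_eq0_absz (x : G) (z : int) : (x *~ z == 0) = (x *+ `|z|%N == 0).
Proof. by case: z => n //=; rewrite NegzE mulrNz oppr_eq0. Qed.

(** The density of a subgroup is the inverse of its index, an integer. *)
Lemma card_tors_index n : #|tors n| = #|G| \/ (2 * #|tors n| <= #|G|)%N.
Proof.
have gt := zmod_closed_group_set (tors_zmod_closed n).
have /dvdnP[q] := cardSg (finset.subsetT (Group gt)).
rewrite cardsT /= cardsE => qE; rewrite qE.
case: q qE => [|[|q]] qE; last by right; rewrite leq_mul2r orbT.
  by have := card_finZmod_gt0 G; rewrite qE.
by left; rewrite mul1n.
Qed.

Lemma tors_full n : #|tors n| = #|G| -> forall x : G, x *+ n = 0.
Proof.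
move=> tG x; apply/eqP; have /eqP/subset_cardP : #|tors n| == #|G| by rewrite tG.
by move=> /(_ (subset_predT _))/(_ x); rewrite !inE.
Qed.

Lemma tors_order n (x : G) : (x \in tors n) = (#[x]%g %| n)%N.
Proof. by rewrite order_dvdn inE FinRing.zmodXgE. Qed.

End torsion.
Arguments tors : clear implicits.
Arguments tors_zmod_closed : clear implicits.

Section words.
Variables (G : finZmodType) (d : nat).
Implicit Types (x : {ffun 'I_d -> G}) (c : {ffun 'I_d -> int}).

Definition linform c x : G := \sum_k x k *~ c k.

Definition lin_ker c : {pred {ffun 'I_d -> G}} := [pred x | linform c x == 0].

Lemma lin_ker_zmod_closed c : GRing.zmod_closed (lin_ker c).
Proof.
split=> [|x y]; rewrite !inE /linform.
  by rewrite big1// => k _; rewrite ffunE mul0rz.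
move=> /eqP x0 /eqP y0.
rewrite (eq_bigr (fun k => x k *~ c k - y k *~ c k)).
  by rewrite sumrB x0 y0 subr0.
by move=> k _; rewrite ffunE [X in _ + X]ffunE mulrzBl.
Qed.

(** Compare with the tuples supported on the coordinate [k], on which the form
    is multiplication by [c k]: solutions are at most as dense as the
    [c k]-torsion. *)
Lemma card_lin_ker_coord c (k : 'I_d) :
  (#|lin_ker c| * #|G| <= #|G| ^ d * #|tors G `|c k|%N|)%N.
Proof.
pose e (g : G) : {ffun 'I_d -> G} := [ffun j => if j == k then g else 0].
have e_inj : injective e.
  by move=> g h /ffunP/(_ k); rewrite !ffunE eqxx.
pose L : {pred {ffun 'I_d -> G}} :=
  [pred x : {ffun _ -> G} | [forall j, (j != k) ==> (x j == 0)]].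
have LE x : reflect (x = e (x k)) (x \in L).
  apply: (iffP forallP) => [xk|-> j]; last first.
    by rewrite /e ffunE; case: (j == k) => /=.
  apply/ffunP => j; rewrite ffunE; case: eqP => [->//|/eqP jk].
  by have /implyP/(_ jk)/eqP := xk j.
have LG : #|L| = #|G|.
  rewrite -(card_codom e_inj); apply: eq_card => x.
  apply/LE/codomP => [->|[g ->]]; first by exists (x k).
  by rewrite {2}/e ffunE eqxx.
have Lz : GRing.zmod_closed L.
  split=> [|x y]; first by apply/forallP => j; rewrite ffunE eqxx implybT.
  move=> /forallP xL /forallP yL; apply/forallP => j; apply/implyP => jk.
  have /implyP/(_ jk)/eqP x0 := xL j; have /implyP/(_ jk)/eqP y0 := yL j.
  by rewrite !ffunE x0 y0 subr0.
rewrite -{1}LG; apply: leq_trans (leq_card_predI (lin_ker_zmod_closed c) Lz) _.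
rewrite card_ffun card_ord leq_mul2l; apply/orP; right.
rewrite -(fintype.card_image e_inj); apply/subset_leq_card/fintype.subsetP => x.
rewrite inE => /andP[xK /LE xE]; apply/fintype.imageP; exists (x k) => //.
rewrite inE -mulrz_eq0_absz; move: xK; rewrite inE /linform (bigD1 k)//= big1 ?addr0//.
by move=> j jk; rewrite xE ffunE (negPf jk) mul0rz.
Qed.

(** Compare with the constant tuples, on which the form is multiplication by
    the sum of its coefficients. *)
Lemma card_lin_ker_diag c (d_gt0 : (0 < d)%N) :
  (#|lin_ker c| * #|G| <= #|G| ^ d * #|tors G `|(\sum_k c k)%R|%N|)%N.
Proof.
pose k0 := Ordinal d_gt0; pose e (g : G) : {ffun 'I_d -> G} := [ffun=> g].
have e_inj : injective e by move=> g h /ffunP/(_ k0); rewrite !ffunE.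
pose L : {pred {ffun 'I_d -> G}} := mem (codom e).
have LG : #|L| = #|G| := card_codom e_inj.
have Lz : GRing.zmod_closed L.
  split=> [|_ _ /codomP[x ->] /codomP[y ->]].
    by apply/codomP; exists 0; apply/ffunP => j; rewrite !ffunE.
  by apply/codomP; exists (x - y); apply/ffunP => j; rewrite !ffunE.
rewrite -{1}LG; apply: leq_trans (leq_card_predI (lin_ker_zmod_closed c) Lz) _.
rewrite card_ffun card_ord leq_mul2l; apply/orP; right.
rewrite -(fintype.card_image e_inj); apply/subset_leq_card/fintype.subsetP => x.
rewrite inE => /andP[xK /codomP[g xE]]; apply/fintype.imageP; exists g => //.
rewrite inE -mulrz_eq0_absz mulrz_sumr; move: xK; rewrite inE /linform xE => /eqP x0.
by apply/eqP; rewrite -[RHS]x0; apply: eq_bigr => j _; rewrite ffunE.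
Qed.

Definition tors_box n : {pred {ffun 'I_d -> G}} := ffun_on (tors G n).

Lemma card_tors_box n : #|tors_box n| = (#|tors G n| ^ d)%N.
Proof. by rewrite card_ffun_on card_ord. Qed.

Lemma tors_box_zmod_closed n : GRing.zmod_closed (tors_box n).
Proof.
have [t0 tB] := tors_zmod_closed G n.
split=> [|x y /ffun_onP xt /ffun_onP yt]; apply/ffun_onP => j; rewrite !ffunE//.
exact: tB.
Qed.

Lemma card_lin_ker_tors_box c n :
  (#|lin_ker c| * #|tors G n| ^ d <=
   #|G| ^ d * #|[predI lin_ker c & tors_box n]|)%N.
Proof.
have -> : (#|G| ^ d)%N = #|{ffun 'I_d -> G}| by rewrite card_ffun card_ord.
rewrite -card_tors_box; exact: leq_card_predI (lin_ker_zmod_closed c) (tors_box_zmod_closed n).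
Qed.

(** A word of length [a] in the alphabet ['I_d] selects [a] entries of a tuple
    [x]; the sum of these entries depends only on the letter counts. *)
Definition occ a (f : {ffun 'I_a -> 'I_d}) (k : 'I_d) : nat :=
  #|[pred i | f i == k]|.

Lemma sum_word a (f : {ffun 'I_a -> 'I_d}) x :
  \sum_i x (f i) = \sum_k x k *+ occ f k.
Proof.
rewrite (partition_big f predT)//=; apply: eq_bigr => k _.
by rewrite -sumr_const; apply: eq_bigr => i /eqP ->.
Qed.

Lemma sum_occ a (f : {ffun 'I_a -> 'I_d}) : (\sum_k occ f k = a)%N.
Proof.
rewrite -[RHS](card_ord a) -sum1_card (partition_big f predT)//=.
by apply: eq_bigr => k _; rewrite sum1_card.
Qed.

Lemma occ_le a (f : {ffun 'I_a -> 'I_d}) k : (occ f k <= a)%N.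
Proof. by rewrite -[leqRHS](card_ord a) max_card. Qed.

Definition occB a b (f : {ffun 'I_a -> 'I_d}) (g : {ffun 'I_b -> 'I_d}) :
  {ffun 'I_d -> int} := [ffun k => (occ f k)%:Z - (occ g k)%:Z].

Lemma sum_word_eq a b (f : {ffun 'I_a -> 'I_d}) (g : {ffun 'I_b -> 'I_d}) x :
  (\sum_i x (f i) == \sum_i x (g i)) = (x \in lin_ker (occB f g)).
Proof.
rewrite -subr_eq0 !sum_word -sumrB inE; congr (_ == 0).
by apply: eq_bigr => k _; rewrite ffunE mulrzBr.
Qed.

(** This is the spectral moment of order [(a, b)] of the circulant matrix of
    [x] (see [circmx_moment]). *)
Definition coinc a b x : nat :=
  #|[pred fg : {ffun 'I_a -> 'I_d} * {ffun 'I_b -> 'I_d} |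
     \sum_i x (fg.1 i) == \sum_i x (fg.2 i)]|.

End words.
Arguments lin_ker G {d} c.
Arguments tors_box : clear implicits.

(** * Counting coincidences between sums of entries *)

Section coincidences.
Variables (G : finZmodType) (d : nat).
Implicit Types (x : {ffun 'I_d -> G}).

Lemma coinc_le a b x : (coinc a b x <= d ^ a * d ^ b)%N.
Proof.
apply: leq_trans (max_card _) _.
by rewrite card_prod !card_ffun !card_ord.
Qed.

Lemma sum_coinc a b (L : {pred {ffun 'I_d -> G}}) :
  (\sum_(x in L) coinc a b x =
   \sum_(fg : {ffun 'I_a -> 'I_d} * {ffun 'I_b -> 'I_d})
     #|[predI lin_ker G (occB fg.1 fg.2) & L]|)%N.
Proof.
under eq_bigr do rewrite /coinc -sum1_card.
rewrite (exchange_big_dep predT)//=; apply: eq_bigr => fg _.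
rewrite sum1_card; apply: eq_card => x.
rewrite -[LHS]/((x \in L) && (\sum_i x (fg.1 i) == \sum_i x (fg.2 i))).
by rewrite sum_word_eq !inE andbC.
Qed.

Lemma absz_sum_occB a (f : {ffun 'I_a -> 'I_d}) (g : {ffun 'I_0 -> 'I_d}) :
  `|(\sum_k occB f g k)%R|%N = a.
Proof.
rewrite -[RHS](sum_occ f) (eq_bigr (fun k => (occ f k)%:Z)).
  by rewrite -(big_morph Posz PoszD (erefl _)).
move=> k _; rewrite ffunE [X in _ - X%:Z](_ : _ = 0%N) ?subr0//.
by apply/eqP; rewrite -leqn0 occ_le.
Qed.

Lemma const_word_torsion k (j : 'I_d) (g : {ffun 'I_0 -> 'I_d}) x :
  x \in tors_box G d k -> x \in lin_ker G (occB [ffun _ : 'I_k => j] g).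
Proof.
move=> /ffun_onP/(_ j); rewrite inE => xk.
rewrite -sum_word_eq big_ord0 (eq_bigr (fun=> x j)) => [|i _]; last by rewrite ffunE.
by rewrite sumr_const card_ord.
Qed.

Hypothesis d_gt0 : (0 < d)%N.

Let fg0 k : {ffun 'I_k -> 'I_d} * {ffun 'I_0 -> 'I_d} :=
  ([ffun=> Ordinal d_gt0], [ffun=> Ordinal d_gt0]).

(** A word that repeats one letter [k] times has sum zero on [k]-torsion
    entries. *)
Lemma coinc_torsion_gt0 k x : x \in tors_box G d k -> (0 < coinc k 0 x)%N.
Proof.
move=> xt; apply/card_gt0P; exists (fg0 k).
by rewrite inE sum_word_eq const_word_torsion.
Qed.

Lemma card_tors_le_coinc_neq0 k :
  (#|tors G k| ^ d <= #|[pred x : {ffun 'I_d -> G} | coinc k 0 x != 0%N]|)%N.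
Proof.
rewrite -card_tors_box; apply/subset_leq_card/fintype.subsetP => x xt.
by rewrite inE -lt0n coinc_torsion_gt0.
Qed.

Lemma sum_coinc_le (L : {pred {ffun 'I_d -> G}}) k (c : nat) :
  (\sum_(x in L) coinc k 0 x <= c * #|L| +
     d ^ k * #|[pred x : {ffun 'I_d -> G} | coinc k 0 x != c]|)%N.
Proof.
rewrite mulnC -sum_nat_const -[X in (_ <= _ + _ * X)%N]sum1_card big_distrr/=.
rewrite [X in (_ <= _ + X)%N]big_mkcond/= [X in (X <= _)%N]big_mkcond.
rewrite [X in (_ <= X + _)%N]big_mkcond/= -big_split/=.
apply: leq_sum => x _; rewrite inE; case: (x \in L) => //=.
case: eqP => [->|_]; rewrite ?addn0//= muln1.
by apply: leq_trans (coinc_le _ _ _) _; rewrite expn0 muln1 leq_addl.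
Qed.

Lemma sum_coinc_ge (c : nat) k :
  (c * #|G| ^ d <= \sum_(x : {ffun 'I_d -> G}) coinc k 0 x +
     c * #|[pred x : {ffun 'I_d -> G} | coinc k 0 x != c]|)%N.
Proof.
rewrite -[X in (X ^ _)%N]/#|G| -{1}(card_ord d) -card_ffun mulnC -sum_nat_const.
rewrite -[X in (_ <= _ + _ * X)%N]sum1_card big_distrr/=.
rewrite [X in (_ <= _ + X)%N]big_mkcond/= -big_split/=.
apply: leq_sum => x _; rewrite inE.
by case: eqP => [->|_]; rewrite ?leq_addr//= muln1 leq_addl.
Qed.

(** Suppose that the [k]-torsion subgroup H is not the whole group; its density
    [t / N] is then at most 1/2. By [card_lin_ker_diag] the mean of the count over
    all tuples is at most [d ^ k * (t / N)]; being close to [c], it bounds [t / N]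
    from below. So tuples with entries in H are not rare, and the mean over them
    is close to [c] too. But every word has at least as high a density of zeros
    over H as over the group, and a constant word gains at least 1/2: the two
    means cannot both be close to [c]. *)
Lemma tors_full_of_coinc k c : (0 < c)%N ->
  ((2 * d ^ k) ^ d * (4 * d ^ k) *
     #|[pred x : {ffun 'I_d -> G} | coinc k 0 x != c]| < #|G| ^ d)%N ->
  #|tors G k| = #|G|.
Proof.
set bad := #|_|; set B := (d ^ k)%N; set N := #|G|; set t := #|tors G k|.
move=> c_gt0 few; case: (card_tors_index G k) => // t2.
have N_gt0 : (0 < N)%N := card_finZmod_gt0 G.
have B_gt0 : (0 < B)%N by rewrite expn_gt0 d_gt0.
have bad_lt : (4 * B * bad < N ^ d)%N.
  apply: leq_ltn_trans few; rewrite -[in leqRHS]mulnA leq_pmull// expn_gt0.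
  by rewrite muln_gt0 B_gt0.
have c_le : (c <= B)%N.
  have [x xc] : exists x : {ffun 'I_d -> G}, coinc k 0 x == c.
    apply/existsP; rewrite -[X in is_true X]negbK negb_exists; apply/negP => /forallP all_bad.
    have : bad = (N ^ d)%N.
      by rewrite /N -[X in (_ ^ X)%N](card_ord d) -card_ffun; apply: eq_card => x; rewrite inE all_bad.
    nia.
  by rewrite -(eqP xc) (leq_trans (coinc_le _ _ _))// expn0 muln1.
set SG := (\sum_(x : {ffun 'I_d -> G}) coinc k 0 x)%N.
have SGE : SG = (\sum_(fg : {ffun 'I_k -> 'I_d} * {ffun 'I_0 -> 'I_d})
   #|lin_ker G (occB fg.1 fg.2)|)%N.
  rewrite /SG sum_coinc; apply: eq_bigr => fg _.
  by apply: eq_card => x; rewrite !inE andbT.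
set SH := (\sum_(x in tors_box G d k) coinc k 0 x)%N.
have SHE := sum_coinc k 0 (tors_box G d k); rewrite -/SH in SHE.
(* the mean of the count over all tuples is at most [B * (t / N)] *)
have up : (SG * N <= N ^ d * (B * t))%N.
  rewrite SGE big_distrl/= (mulnC B) mulnA.
  apply: (@leq_trans (\sum_(fg : {ffun 'I_k -> 'I_d} * {ffun 'I_0 -> 'I_d}) N ^ d * t)).
    apply: leq_sum => fg _; have := card_lin_ker_diag G (occB fg.1 fg.2) d_gt0.
    by rewrite absz_sum_occB.
  by rewrite sum_nat_const card_prod !card_ffun !card_ord expn0 muln1 mulnC.
(* the mean over the torsion tuples exceeds the mean over all tuples by at
   least 1/2, thanks to the constant word [fg0 k] *)
have gap : (2 * SG * t ^ d + t ^ d * N ^ d <= 2 * N ^ d * SH)%N.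
  rewrite SGE SHE (bigD1 (fg0 k))//= [in leqRHS](bigD1 (fg0 k))//=.
  rewrite [X in (_ <= _ * (X + _))%N](_ : _ = (t ^ d)%N); last first.
    rewrite -card_tors_box; apply: eq_card => x.
    rewrite [in LHS]inE/=; case: (boolP (x \in tors_box G d k)); rewrite ?andbF ?andbT// => xt.
    exact: const_word_torsion.
  have := card_lin_ker_diag G (occB (fg0 k).1 (fg0 k).2) d_gt0.
  rewrite absz_sum_occB -/t -/N; set K0 := #|_|.
  have : ((\sum_(i | i != fg0 k) #|lin_ker G (occB i.1 i.2)|) * t ^ d <=
     N ^ d * \sum_(i | i != fg0 k) #|[predI lin_ker G (occB i.1 i.2) & tors_box G d k]|)%N.
    by rewrite big_distrl big_distrr/=; apply: leq_sum => fg _; exact: card_lin_ker_tors_box.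
  set S1 := (\sum_(i | _) _)%N; set S2 := (\sum_(i | _) _)%N => S12 K0N.
  have {}K0N : (2 * K0 <= N ^ d)%N.
    rewrite -(leq_pmul2r N_gt0); have := leq_mul (leqnn (N ^ d)) t2.
    by move: K0N; lia.
  have : (2 * K0 * t ^ d <= N ^ d * t ^ d)%N by rewrite leq_mul2r K0N orbT.
  by move: S12; lia.
have upH := sum_coinc_le (tors_box G d k) k c.
rewrite card_tors_box -/SH -/bad -/B -/t in upH.
have loG := sum_coinc_ge c k; rewrite -/SG -/bad -/N in loG.
have t_leN : (t <= N)%N by lia.
have tdNd : (t ^ d <= N ^ d)%N by rewrite leq_exp2r.
(* the 1/2 gap can only come from exceptional tuples *)
have : (t ^ d <= 4 * B * bad)%N.
  have h1 : (2 * SG * t ^ d + t ^ d * N ^ d <= 2 * N ^ d * (c * t ^ d + B * bad))%N.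
    by apply: leq_trans gap _; rewrite leq_mul2l upH orbT.
  have h2 : (2 * t ^ d * (c * N ^ d) <= 2 * t ^ d * (SG + c * bad))%N.
    by rewrite leq_mul2l loG orbT.
  have h3 : (c * bad * t ^ d <= B * bad * N ^ d)%N by rewrite leq_mul// leq_mul2r c_le orbT.
  rewrite -(@leq_pmul2r (N ^ d)) ?expn_gt0 ?N_gt0//.
  by move: h1 h2 h3; lia.
(* lower bound on the density of the torsion, as [c > 0] *)
have : (N <= 2 * B * t)%N.
  have h1 : (N ^ d <= 2 * SG)%N.
    have : (c * N ^ d <= SG + B * bad)%N.
      by apply: leq_trans loG _; rewrite leq_add2l leq_mul2r c_le orbT.
    have : (N ^ d <= c * N ^ d)%N by rewrite leq_pmull.
    by move: bad_lt; lia.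
  rewrite -(@leq_pmul2l (N ^ d)) ?expn_gt0 ?N_gt0//.
  apply: leq_trans (_ : 2 * SG * N <= _)%N; first by rewrite leq_mul2r h1 orbT.
  by move: up; lia.
move=> Nt tb; exfalso; move: few; apply/negP; rewrite -leqNgt.
have : (N ^ d <= (2 * B * t) ^ d)%N by rewrite leq_exp2r.
rewrite expnMn => /leq_trans; apply; rewrite -mulnA leq_mul2l.
by rewrite tb orbT.
Qed.

End coincidences.

Section coincidence_limit.
Variables (G : finZmodType) (d : nat).

(** For generic tuples in a group whose elements mostly have order [M], only the
    pairs of words with letter counts congruent modulo [M] have equal sums. *)
Definition words_match M a b (fg : {ffun 'I_a -> 'I_d} * {ffun 'I_b -> 'I_d}) :=
  [forall k, (M %| `|occB fg.1 fg.2 k|)%N].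

Definition coinc_lim M a b : nat := #|[pred fg | @words_match M a b fg]|.

(** Union bound: a tuple with an exceptional count is exceptional for some pair
    of words. *)
Lemma card_coinc_neq_lim M a b :
  (#|[pred x : {ffun 'I_d -> G} | coinc a b x != coinc_lim M a b]| <=
   \sum_(fg : {ffun 'I_a -> 'I_d} * {ffun 'I_b -> 'I_d})
     #|[pred x : {ffun 'I_d -> G} |
        (x \in lin_ker G (occB fg.1 fg.2)) != words_match M fg]|)%N.
Proof.
under eq_bigr do rewrite -sum1_card.
rewrite (exchange_big_dep predT)//= -sum1_card big_mkcond/=.
apply: leq_sum => x _; case: ifP => //; rewrite inE => /eqP neq.
rewrite sum1_card; apply/card_gt0P.
have [fg fgP|all_eq] := pickP (fun fg : {ffun 'I_a -> 'I_d} * {ffun 'I_b -> 'I_d} =>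
  (x \in lin_ker G (occB fg.1 fg.2)) != words_match M fg); first by exists fg.
case: neq; apply: eq_card => fg.
rewrite -[LHS]/(\sum_i x (fg.1 i) == \sum_i x (fg.2 i)) sum_word_eq.
by have /negbFE/eqP := all_eq fg.
Qed.

Lemma card_exceptions_unmatched M a b
    (fg : {ffun 'I_a -> 'I_d} * {ffun 'I_b -> 'I_d}) : ~~ words_match M fg ->
  exists2 n, (n <= a + b)%N && ~~ (M %| n)%N &
   (#|[pred x : {ffun 'I_d -> G} |
        (x \in lin_ker G (occB fg.1 fg.2)) != words_match M fg]| * #|G| <=
    #|G| ^ d * #|tors G n|)%N.
Proof.
move=> nmatch; have /forallPn[k kM] := nmatch; exists `|occB fg.1 fg.2 k|%N.
  rewrite kM andbT ffunE.
  by have := occ_le fg.1 k; have := occ_le fg.2 k; lia.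
apply: leq_trans (card_lin_ker_coord G (occB fg.1 fg.2) k).
rewrite leq_mul2r; apply/orP; right; apply/subset_leq_card/fintype.subsetP => x.
by rewrite inE (negPf nmatch) eqbF_neg negbK.
Qed.

Lemma card_exceptions_matched M a b
    (fg : {ffun 'I_a -> 'I_d} * {ffun 'I_b -> 'I_d}) : words_match M fg ->
  (forall n, (n <= a + b)%N -> (M %| n)%N -> forall g : G, g *+ n = 0) ->
  #|[pred x : {ffun 'I_d -> G} |
        (x \in lin_ker G (occB fg.1 fg.2)) != words_match M fg]| = 0%N.
Proof.
move=> match_fg kill; apply: eq_card0 => x; rewrite inE match_fg eqb_id; apply/negbF; rewrite inE.
rewrite /linform big1// => k _; apply/eqP; rewrite mulrz_eq0_absz kill//.
  by rewrite ffunE; have := occ_le fg.1 k; have := occ_le fg.2 k; lia.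
exact: (forallP match_fg).
Qed.

End coincidence_limit.

(** * Spectral moments of circulant matrices *)

Section normal_matrices.
Variables (F : numClosedFieldType) (n : nat).
Import spectral.
Local Open Scope sesquilinear_scope.

Lemma char_poly_conj (P D : 'M[F]_n) : P \in unitmx ->
  char_poly (invmx P *m D *m P) = char_poly D.
Proof.
move=> uP; rewrite /char_poly /char_poly_mx.
have <- : map_mx polyC (invmx P) *m ('X%:M - map_mx polyC D) *m map_mx polyC P
   = 'X%:M - map_mx polyC (invmx P *m D *m P).
  rewrite !map_mxM/= mulmxBr mulmxBl; congr (_ - _).
  by rewrite mul_mx_scalar -scalemxAl -map_mxM mulVmx// map_mx1 scalemx1.
rewrite !det_mulmx mulrAC -det_mulmx -map_mxM mulVmx//.
by rewrite map_mx1 det1 mul1r.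
Qed.

Lemma conjmx_expr (P : 'M[F]_n) (u : 'rV[F]_n) a : P \in unitmx ->
  (invmx P *m diag_mx u *m P) ^+ a =
  invmx P *m diag_mx (\row_i u 0 i ^+ a) *m P.
Proof.
move=> uP; elim: a => [|a IH].
  rewrite expr0 (_ : \row_i _ = const_mx 1).
    by rewrite diag_const_mx mulmx1 mulVmx.
  by apply/rowP => i; rewrite !mxE expr0.
rewrite exprS IH -[_ * _]/(_ *m _) !mulmxA mulmxK// -[_ *m diag_mx u *m _]mulmxA.
rewrite mulmx_diag; congr (_ *m diag_mx _ *m _).
by apply/rowP => i; rewrite !mxE exprS.
Qed.

(** A unitary change of basis diagonalises a normal matrix together with its
    adjoint, and the trace of a product of their powers is then read off on the
    diagonal. *)
Lemma normalmx_moments (A : 'M[F]_n) : A \is normalmx ->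
  exists2 D : 'rV[F]_n, char_poly A = \prod_i ('X - (D 0 i)%:P) &
    forall a b, \tr (A ^+ a * (A ^t*) ^+ b) = \sum_i D 0 i ^+ a * (D 0 i)^* ^+ b.
Proof.
move=> /orthomx_spectralP.
set P := spectralmx A; set D := spectral_diag A => AE.
have uP : P \in unitmx := spectral_unit A.
have AtE : A ^t* = invmx P *m diag_mx (map_mx Num.conj D) *m P.
  rewrite AE; rewrite (invmx_unitary (spectral_unitarymx A)).
  by rewrite !trmx_mul !map_mxM/= -/P trmxCK tr_diag_mx map_diag_mx mulmxA.
exists D => [|a b].
  rewrite AE char_poly_conj// char_poly_trig ?diag_mx_is_trig//.
  by apply: eq_bigr => i _; rewrite mxE eqxx.
rewrite AtE AE !conjmx_expr// -[_ * _]/(_ *m _) !mulmxA mulmxK//.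
rewrite -[invmx P *m _ *m diag_mx _]mulmxA.
rewrite mulmx_diag mxtrace_mulC mulmxA mulmxV// mul1mx mxtrace_diag.
by apply: eq_bigr => i _; rewrite !mxE.
Qed.

End normal_matrices.

Section eigenvalues.
Variables (R : realType) (n : nat).
Implicit Types A : 'M[R[i]]_n.
Import spectral.
Local Open Scope sesquilinear_scope.

Lemma sum_eigenvalues_normalmx A a b : A \is normalmx ->
  \sum_(z <- eigenvalues A) (z : R[i]) ^+ a * (z^*)%R ^+ b = \tr (A ^+ a * (A ^t*) ^+ b).
Proof.
move=> /normalmx_moments[D AD ->].
have eigE : perm_eq (eigenvalues A : seq R[i]) [seq D 0 i | i <- enum 'I_n].
  by apply: prod_XsubC_eq; rewrite -char_poly_eigenvalues AD big_map big_enum.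
by rewrite (perm_big _ eigE)/= big_map big_enum.
Qed.

(** For a left eigenvector [v], compare the l1 norms of [v *m A] and [v]. *)
Lemma eigenvalues_norm_le A (r : R[i]) z :
  (forall i, \sum_j `|A i j| <= r) -> z \in (eigenvalues A : seq R[i]) -> `|z| <= r.
Proof.
move=> rowA zA; have /eigenvalueP[v vA v0] : eigenvalue A z.
  by rewrite eigenvalue_root_char char_poly_eigenvalues root_prod_XsubC.
have s_gt0 : 0 < \sum_i `|v 0 i|.
  rewrite lt_def sumr_ge0// andbT psumr_neq0//; apply/hasP.
  have /rV0Pn[i vi] := v0; exists i; first by rewrite mem_index_enum.
  by rewrite /= normr_gt0.
rewrite -(ler_pM2r s_gt0) mulr_sumr.
rewrite (eq_bigr (fun j => `|\sum_i v 0 i * A i j|)); last first.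
  by move=> j _; have /rowP/(_ j) := vA; rewrite !mxE => ->; rewrite normrM.
apply: (@le_trans _ _ (\sum_j \sum_i `|v 0 i| * `|A i j|)).
  apply: ler_sum => j _; apply: le_trans (ler_norm_sum _ _ _) _.
  by apply: ler_sum => i _; rewrite normrM.
rewrite exchange_big mulr_sumr; apply: ler_sum => i _.
by rewrite -mulr_sumr mulrC ler_wpM2r.
Qed.

End eigenvalues.

Section translation_matrices.
Variables (R : realType) (G : finZmodType).
Import spectral.
Local Open Scope sesquilinear_scope.

(** The permutation matrix of the translation by [g]. *)
Definition transmx (g : G) : 'M[R[i]]_#|G| :=
  \matrix_(i, j) (enum_val i - enum_val j == g)%:R.

Lemma transmx0 : transmx 0 = 1.
Proof.
by apply/matrixP => i j; rewrite !mxE subr_eq0 (inj_eq enum_val_inj).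
Qed.

Lemma transmxD g h : transmx (g + h) = transmx g * transmx h.
Proof.
apply/matrixP => i j; rewrite !mxE (bigD1 (enum_rank (enum_val i - g)))//=.
rewrite !mxE enum_rankK subKr eqxx mul1r big1 ?addr0.
  by rewrite [in RHS]addrAC [in RHS]subr_eq [h + g]addrC.
move=> k kg; rewrite !mxE; case: eqP => [kE|]; rewrite ?mul0r//.
by case/eqP: kg; rewrite -kE subKr enum_valK.
Qed.

Lemma transmx_sum (I : finType) (x : I -> G) :
  \prod_i transmx (x i) = transmx (\sum_i x i).
Proof. by rewrite (big_morph transmx transmxD transmx0). Qed.

Lemma transmx_adj g : (transmx g)^t* = transmx (- g).
Proof.
apply/matrixP => i j; rewrite !mxE rmorph_nat -eqr_oppLR opprB.
by [].
Qed.

Lemma mxtrace_transmx g : \tr (transmx g) = #|G|%:R * (g == 0)%:R.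
Proof.
rewrite /mxtrace (eq_bigr (fun=> (g == 0)%:R)).
  by rewrite sumr_const card_ord mulr_natl.
by move=> i _; rewrite mxE subrr eq_sym.
Qed.

Definition circmx d (x : {ffun 'I_d -> G}) : 'M[R[i]]_#|G| :=
  \sum_k transmx (x k).

Lemma circmx_adj d (x : {ffun 'I_d -> G}) : (circmx x)^t* = circmx (- x).
Proof.
rewrite /circmx raddf_sum raddf_sum/=; apply: eq_bigr => k _.
by rewrite ffunE transmx_adj.
Qed.

Lemma circmx_exp d (x : {ffun 'I_d -> G}) a :
  circmx x ^+ a = \sum_(f : {ffun 'I_a -> 'I_d}) transmx (\sum_i x (f i)).
Proof.
rewrite -[X in _ ^+ X](card_ord a) -prodr_const bigA_distr_bigA.
by apply: eq_bigr => f _; rewrite transmx_sum.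
Qed.

Lemma circmx_normal d (x : {ffun 'I_d -> G}) : circmx x \is normalmx.
Proof.
apply/normalmxP; rewrite circmx_adj /circmx -[_ *m _]/(_ * _) -[RHS]/(_ * _).
rewrite !mulr_sumr; under eq_bigr do rewrite mulr_suml.
under [RHS]eq_bigr do rewrite mulr_suml.
rewrite exchange_big; apply: eq_bigr => i _; apply: eq_bigr => j _.
by rewrite -!transmxD addrC.
Qed.

(** Expanding the powers of a sum of translation matrices gives one translation
    per pair of words, by the difference of the two word sums; the trace of a
    translation is [#|G|] if it is trivial and 0 otherwise. *)
Lemma circmx_moment d (x : {ffun 'I_d -> G}) a b :
  \sum_(z <- eigenvalues (circmx x)) (z : R[i]) ^+ a * (z^*)%R ^+ b =
  #|G|%:R * (coinc a b x)%:R.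
Proof.
rewrite sum_eigenvalues_normalmx ?circmx_normal// circmx_adj !circmx_exp.
rewrite [X in \tr X]mulr_sumr raddf_sum/=.
under eq_bigr do rewrite mulr_suml raddf_sum/=.
have -> : (coinc a b x)%:R = \sum_(fg : {ffun 'I_a -> 'I_d} * {ffun 'I_b -> 'I_d})
    (\sum_i x (fg.1 i) == \sum_i x (fg.2 i))%:R :> R[i].
  by rewrite -natr_sum /coinc -sum1_card big_mkcond.
rewrite [RHS]mulr_sumr [LHS]exchange_big [LHS]pair_big/=.
apply: eq_bigr => -[f g] _; rewrite -transmxD mxtrace_transmx/=.
rewrite (eq_bigr (fun i => - x (g i))); last by move=> i _; rewrite ffunE.
by rewrite sumrN subr_eq0.
Qed.

Lemma circmx_eigenvalue_le d (x : {ffun 'I_d -> G}) z :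
  z \in (eigenvalues (circmx x) : seq R[i]) -> `|z| <= d%:R.
Proof.
apply: eigenvalues_norm_le => i.
apply: (@le_trans _ _ (\sum_j \sum_k transmx (x k) i j)).
  apply: ler_sum => j _; rewrite /circmx summxE ger0_norm// sumr_ge0// => k _.
  by rewrite mxE.
rewrite exchange_big -[leRHS](_ : \sum_(k < d) 1 = _); last by rewrite sumr_const card_ord.
apply: ler_sum => k _; rewrite (bigD1 (enum_rank (enum_val i - x k)))//= big1 ?addr0.
  by rewrite mxE lern1 leq_b1.
move=> j jk; rewrite mxE; case: eqP => // xkE.
by case/eqP: jk; rewrite -xkE subKr enum_valK.
Qed.

End translation_matrices.

(** * From random circulant matrices to random tuples *)

Section circulant_supports.
Variables (R : realType) (G : finZmodType) (d : nat).
Implicit Types (x y : {ffun 'I_d -> G}).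

Lemma circmxE x u v :
  circmx R x (enum_rank u) (enum_rank v) = \sum_k (u - v == x k)%:R.
Proof.
by rewrite /circmx summxE; apply: eq_bigr => k _; rewrite mxE !enum_rankK.
Qed.

Lemma sum_eq_inj x (g : G) : injective x ->
  \sum_k (g == x k)%:R = (g \in codom x)%:R :> R[i].
Proof.
move=> x_inj; case: (boolP (g \in codom x)) => [/codomP[k ->]|gx].
  rewrite (bigD1 k)//= eqxx big1 ?addr0// => j jk.
  by rewrite (inj_eq x_inj) eq_sym (negPf jk).
rewrite big1// => k _; case: eqP => // gE.
by rewrite gE codom_f in gx.
Qed.

Lemma card_sub_codom x (f : 'I_#|G| -> G) : injective x -> bijective f ->
  #|[set i | f i \in codom x]%SET| = d.
Proof.
move=> x_inj [h fK hK]; rewrite -[RHS](card_ord d) -(card_codom x_inj).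
rewrite -(card_imset (mem (codom x)) (can_inj hK)); apply: eq_card => i.
rewrite inE; apply/idP/imsetP => [fi|[g gx ->]]; last by rewrite hK.
by exists (f i).
Qed.

Lemma circmx_Mat x : injective x -> Mat R d G (circmx R x).
Proof.
move=> x_inj.
have E i j : circmx R x i j = (enum_val i - enum_val j \in codom x)%:R.
  by rewrite -[in LHS](enum_valK i) -[in LHS](enum_valK j) circmxE sum_eq_inj.
have e1 (b : bool) : (b%:R == 1 :> R[i]) = b by case: b; rewrite ?eqxx// eq_sym oner_eq0.
split.
- exists (fun g => \sum_k (g == x k)%:R) => u v; exact: circmxE.
- by move=> i j; rewrite E; case: (_ \in _); [right|left].
- move=> i; rewrite -[RHS](@card_sub_codom x (fun j => enum_val i - enum_val j))//.
    by apply: eq_card => j; rewrite !inE E e1.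
  exists (fun g => enum_rank (enum_val i - g)) => g.
    by rewrite subKr enum_valK.
  by rewrite enum_rankK subKr.
- move=> j; rewrite -[RHS](@card_sub_codom x (fun i => enum_val i - enum_val j))//.
    by apply: eq_card => i; rewrite !inE E e1.
  exists (fun g => enum_rank (g + enum_val j)) => g.
    by rewrite subrK enum_valK.
  by rewrite enum_rankK addrK.
Qed.

(** The rows where the column of index 0 is nonzero list the [d] entries of the
    tuple. *)
Lemma Mat_circmx A : Mat R d G A -> exists2 x : {ffun 'I_d -> G}, injective x & A = circmx R x.
Proof.
move=> [[a aE] A01 _ col_d].
pose S := [set g | a g == 1]%SET.
have cS : #|S| = d.
  rewrite -[RHS](col_d (enum_rank 0)) -(card_imset S enum_rank_inj).
  apply: eq_card => i; rewrite inE; apply/imsetP/idP => [[g]|Ai].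
    by rewrite inE => ag ->; rewrite aE subr0.
  exists (enum_val i); rewrite ?enum_valK// inE.
  by rewrite -[enum_val i]subr0 -aE enum_valK.
pose x : {ffun 'I_d -> G} := [ffun k => enum_val (cast_ord (esym cS) k)].
have x_inj : injective x.
  by move=> k l; rewrite !ffunE => /enum_val_inj/cast_ord_inj.
exists x => //; apply/matrixP => i j.
rewrite -(enum_valK i) -(enum_valK j) circmxE sum_eq_inj// aE.
set g := _ - _; have ag : a g = 0 \/ a g = 1 by rewrite -aE; exact: A01.
have -> : (g \in codom x) = (g \in S).
  apply/codomP/idP => [[k ->]|gS]; first by rewrite ffunE enum_valP.
  exists (cast_ord cS (enum_rank_in gS g)).
  by rewrite ffunE cast_ordK enum_rankK_in.
by rewrite inE; case: ag => ->; rewrite ?eqxx// eq_sym oner_eq0.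
Qed.

Lemma circmx_eqP x y : injective x -> injective y ->
  (circmx R y == circmx R x) = (y \in ffun_on (mem (codom x))).
Proof.
move=> x_inj y_inj; apply/eqP/ffun_onP => [xy k|xy].
  have := circmxE y (y k) 0; rewrite xy circmxE !sum_eq_inj// subr0 codom_f.
  by case: (y k \in codom x) => // /eqP; rewrite eq_sym oner_eq0.
apply/matrixP => i j; rewrite -(enum_valK i) -(enum_valK j) !circmxE !sum_eq_inj//.
congr (_%:R); congr nat_of_bool.
have /subset_cardP cod : #|mem (codom y)| = #|mem (codom x)| by rewrite !card_codom.
apply: (cod _ _); apply/fintype.subsetP => _ /codomP[k ->]; exact: xy.
Qed.

(** A circulant matrix determines the set of the entries of an injective tuple,
    hence the tuple up to a permutation. *)
Lemma card_circmx_fiber x : injective x ->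
  #|[pred y : {ffun 'I_d -> G} | injectiveb y && (circmx R y == circmx R x)]| = d`!.
Proof.
move=> x_inj; have := card_inj_ffuns_on 'I_d (mem (codom x)).
rewrite card_ord [in RHS](card_codom x_inj) card_ord ffactnn => <-.
apply: eq_card => y; rewrite !inE andbC; case: (injectiveP y) => yi; rewrite ?andbF//.
by rewrite !andbT circmx_eqP.
Qed.

(** The equation [x i = x j] has a coefficient equal to 1, and the 1-torsion is
    trivial. *)
Lemma card_not_inj : (#|[pred x : {ffun 'I_d -> G} | ~~ injectiveb x]| * #|G| <= d ^ 2 * #|G| ^ d)%N.
Proof.
pose c (ij : 'I_d * 'I_d) : {ffun 'I_d -> int} :=
  [ffun k => (k == ij.1)%:Z - (k == ij.2)%:Z].
have cE ij x : (x \in lin_ker G (c ij)) = (x ij.1 == x ij.2).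
  rewrite -subr_eq0 inE /linform; congr (_ == 0).
  rewrite (eq_bigr (fun k => x k *+ (k == ij.1) - x k *+ (k == ij.2))).
    rewrite sumrB (bigD1 ij.1)//= (bigD1 (F := fun k => x k *+ (k == ij.2)) ij.2)//=.
    rewrite !eqxx !mulr1n !big1 ?addr0// => k /negPf ->; by rewrite mulr0n.
  by move=> k _; rewrite ffunE mulrzBr.
apply: (@leq_trans ((\sum_(ij | ij.1 != ij.2) #|lin_ker G (c ij)|) * #|G|)).
  rewrite leq_mul2r; apply/orP; right.
  under eq_bigr do rewrite -sum1_card.
  rewrite (exchange_big_dep predT)//= -sum1_card big_mkcond/=.
  apply: leq_sum => x _; case: ifP => //; rewrite inE => /injectivePn[i [j ij xij]].
  rewrite sum1_card; apply/card_gt0P; exists (i, j).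
  change (((i, j).1 != (i, j).2) && (x \in lin_ker G (c (i, j)))).
  by rewrite cE/= ij xij eqxx.
rewrite big_distrl/=.
apply: (@leq_trans (\sum_(ij : 'I_d * 'I_d) #|G| ^ d)); last first.
  by rewrite sum_nat_const card_prod card_ord.
rewrite big_mkcond/=; apply: leq_sum => -[i j] _; case: ifP => //= ij.
apply: leq_trans (card_lin_ker_coord G (c (i, j)) i) _.
rewrite ffunE/= eqxx (negPf ij) subr0.
rewrite -[leqRHS]muln1 leq_mul2l; apply/orP; right.
rewrite -(card1 (0 : G)); apply/subset_leq_card/fintype.subsetP => g.
by rewrite !inE mulr1n.
Qed.

End circulant_supports.

Section uniform_circulant.
Variables (R : realType) (G : finZmodType) (d : nat).
Variables (disp : measure_display) (Omega : measurableType disp).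
Variables (P : probability Omega R) (C : Omega -> 'M[R[i]]_#|G|).
Hypothesis C_uniform : uniformly_distributed P (Mat R d G) C.
Local Open Scope classical_set_scope.

Lemma card_inj_circmx_in (B : set 'M[R[i]]_#|G|) : B `<=` Mat R d G ->
  #|[pred x : {ffun 'I_d -> G} | injectiveb x && `[< B (circmx R x) >]]| =
  (#|` fset_set B| * d`!)%N.
Proof.
move=> BM; have finB : finite_set B by apply: sub_finite_set BM (finite_Mat _ _ _).
have inB A : (A \in fset_set B) = `[< B A >].
  by rewrite in_fset_set//; apply/idP/asboolP; rewrite inE.
have -> : (#|` fset_set B| * d`! = \sum_(A <- fset_set B) d`!)%N.
  by rewrite big_const_seq count_predT iter_addn_0 mulnC.
rewrite [RHS](eq_big_seq (fun A => \sum_(x : {ffun 'I_d -> G} |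
    injectiveb x && (circmx R x == A)) 1)%N); last first.
  move=> A; rewrite inB => /asboolP /BM /Mat_circmx[x x_inj ->].
  by rewrite -(card_circmx_fiber R x_inj) -sum1_card; apply: eq_bigl => y; rewrite inE.
rewrite (exchange_big_dep (fun x : {ffun 'I_d -> G} => injectiveb x))/=; last first.
  by move=> A x _ /andP[].
rewrite -sum1_card [LHS](_ : _ = \sum_(x : {ffun 'I_d -> G} | injectiveb x)
    (`[< B (circmx R x) >] : nat))%N; last first.
  rewrite big_mkcond [RHS]big_mkcond/=; apply: eq_bigr => x _; rewrite inE.
  by case: (injectiveb x); case: asbool.
apply: eq_bigr => x -> /=; rewrite -inB.
rewrite sum1_count/=.
rewrite (eq_count (a2 := pred1 (circmx R x))); last by move=> A; rewrite /= eq_sym.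
by rewrite count_uniq_mem// finmap.fset_uniq.
Qed.

Lemma uniform_circulant_prob (Q : set 'M[R[i]]_#|G|) :
  measurable [set w | Q (C w)] /\
  P [set w | Q (C w)] = ((#|` fset_set (Mat R d G `&` Q)|)%:R /
    (#|` fset_set (Mat R d G)|)%:R)%:E.
Proof.
have [CM CP] := C_uniform.
have -> : [set w | Q (C w)] =
    \bigcup_(A in Mat R d G `&` Q) (C @^-1` [set A]).
  apply/seteqP; split=> [w Qw|w [A [_ QA] CA]]; last by rewrite /= CA.
  by exists (C w) => //=; split.
have finMQ : finite_set (Mat R d G `&` Q).
  by apply: finite_setIl; exact: finite_Mat.
have mC A : (Mat R d G `&` Q) A -> measurable (C @^-1` [set A]).
  by case=> MA _; have [? _] := CP A MA.
split; first exact: fin_bigcup_measurable.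
rewrite measure_fin_bigcup//=; last first.
  by move=> A B _ _ [w [<- <-]].
rewrite fsbig_finite//= (eq_big_seq (fun=> ((#|` fset_set (Mat R d G)|)%:R^-1)%:E)).
  rewrite sumEFin big_const_seq count_predT iter_addr_0.
  by rewrite [in RHS]mulr_natl.
move=> A; rewrite in_fset_set// inE => -[MA _].
by have [_ ->] := CP A MA.
Qed.

(** All fibres of [circmx] over the support of the law have the same cardinal
    [d`!], so a uniform circulant matrix is the matrix of a uniform injective
    tuple. *)
Lemma uniform_circulant_tuples (Q : set 'M[R[i]]_#|G|) :
  P [set w | Q (C w)] =
  (#|[pred x : {ffun 'I_d -> G} | injectiveb x && `[< Q (circmx R x) >]]|%:R /
   #|[pred x : {ffun 'I_d -> G} | injectiveb x]|%:R)%:E.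
Proof.
rewrite (uniform_circulant_prob Q).2; congr (_%:E).
have -> : #|[pred x : {ffun 'I_d -> G} | injectiveb x && `[< Q (circmx R x) >]]| =
   (#|` fset_set (Mat R d G `&` Q)| * d`!)%N.
  rewrite -card_inj_circmx_in//; apply: eq_card => x; rewrite !inE.
  case: (injectiveP x) => //= xi; apply/asboolP/asboolP => [|[]]//.
  by split=> //; exact: circmx_Mat.
have -> : #|[pred x : {ffun 'I_d -> G} | injectiveb x]| =
   (#|` fset_set (Mat R d G)| * d`!)%N.
  rewrite -card_inj_circmx_in//; apply: eq_card => x; rewrite !inE.
  case: (injectiveP x) => //= xi; apply/esym/asboolP; exact: circmx_Mat.
by rewrite !natrM -mulf_div divff ?mulr1// pnatr_eq0 -lt0n fact_gt0.
Qed.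

Let N : R := #|G|%:R.

Let N_gt0 : 0 < N.
Proof. by rewrite ltr0n card_finZmod_gt0. Qed.

Let inj_ge : (1 - d%:R ^+ 2 / N) * N ^+ d <=
  #|[pred x : {ffun 'I_d -> G} | injectiveb x]|%:R.
Proof.
have := card_not_inj G d; rewrite -(ler_nat R) !natrM !natrX -/N.
have -> : #|[pred x : {ffun 'I_d -> G} | ~~ injectiveb x]|%:R =
    N ^+ d - #|[pred x : {ffun 'I_d -> G} | injectiveb x]|%:R.
  apply/eqP; rewrite -subr_eq opprK eq_sym /N -natrX -natrD eqr_nat.
  have := cardC [pred x : {ffun 'I_d -> G} | injectiveb x].
  by rewrite card_ffun card_ord addnC => <-.
rewrite -ler_pdivlMr// => h.
rewrite mulrBl mul1r lerBlDr -lerBlDl; apply: le_trans h _.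
by rewrite mulrAC.
Qed.

(** Dropping the injectivity of the tuple costs little, since most tuples are
    injective in a large group. *)
Lemma uniform_circulant_le (Q : set 'M[R[i]]_#|G|) : (2 * d ^ 2 <= #|G|)%N ->
  (P [set w | Q (C w)] <=
   (2 * (#|[pred x : {ffun 'I_d -> G} | `[< Q (circmx R x) >]]|%:R / N ^+ d))%:E)%E.
Proof.
move=> dN; rewrite uniform_circulant_tuples lee_fin.
have half : N ^+ d / 2 <= #|[pred x : {ffun 'I_d -> G} | injectiveb x]|%:R.
  apply: le_trans inj_ge; rewrite mulrC ler_pM2r ?exprn_gt0//.
  rewrite lerBrDr -lerBrDl ler_pdivrMr//.
  by move: dN; rewrite -(ler_nat R) natrM natrX -/N; lra.
have Nd : 0 < N ^+ d / 2 by rewrite divr_gt0// exprn_gt0.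
rewrite ler_pdivrMr ?(lt_le_trans Nd)//.
apply: le_trans (_ : 2 * (#|[pred x : {ffun 'I_d -> G} | `[< Q (circmx R x) >]]|%:R
    / N ^+ d) * (N ^+ d / 2) <= _).
  rewrite (_ : _ * (N ^+ d / 2) =
    #|[pred x : {ffun 'I_d -> G} | `[< Q (circmx R x) >]]|%:R).
    rewrite ler_nat; apply/subset_leq_card/fintype.subsetP => x.
    by rewrite !inE => /andP[_ /asboolP].
  by field; rewrite expf_neq0// gt_eqF.
by rewrite ler_wpM2l// mulr_ge0// divr_ge0// exprn_ge0// ltW.
Qed.

Lemma uniform_circulant_ge (Q : set 'M[R[i]]_#|G|) :
  ((#|[pred x : {ffun 'I_d -> G} | `[< Q (circmx R x) >]]|%:R / N ^+ d)%:E <=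
   P [set w | Q (C w)] + (d%:R ^+ 2 / N)%:E)%E.
Proof.
rewrite uniform_circulant_tuples -EFinD lee_fin.
set A := #|_|; set B := #|_|; set I := #|_|.
have AB : A%:R <= B%:R + (N ^+ d - I%:R) :> R.
  rewrite addrA lerBrDr /N -natrX -!natrD ler_nat.
  rewrite (_ : #|G| ^ d = #|{ffun 'I_d -> G}|)%N; last by rewrite card_ffun card_ord.
  rewrite -(cardC [pred x : {ffun 'I_d -> G} | injectiveb x]) addnCA -/I addnC leq_add2l.
  rewrite /A -(cardID [pred x : {ffun 'I_d -> G} | injectiveb x]).
  apply: leq_add; apply/subset_leq_card/fintype.subsetP => x; rewrite !inE.
    by case/andP=> -> ->.
  by case/andP.
have Nd : 0 < N ^+ d by rewrite exprn_gt0.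
have BI : (B <= I)%N.
  by apply/subset_leq_card/fintype.subsetP => x; rewrite !inE => /andP[].
have IN : I%:R <= N ^+ d.
  by rewrite /N -natrX ler_nat (leq_trans (max_card _))// card_ffun card_ord.
have {}BI : B%:R / N ^+ d <= B%:R / I%:R.
  have [I0|I0] := eqVneq I 0%N.
    by move: BI; rewrite I0 leqn0 => /eqP ->; rewrite !mul0r.
  by rewrite ler_wpM2l// lef_pV2// posrE// ltr0n lt0n.
apply: le_trans (_ : B%:R / N ^+ d + (d%:R ^+ 2 / N) <= _); last by rewrite lerD2r.
rewrite ler_pdivrMr// mulrDl divfK ?gt_eqF//.
apply: le_trans AB _; rewrite lerD2l.
by move: inj_ge; rewrite mulrBl mul1r; lra.
Qed.

End uniform_circulant.

(** * Polynomials in a complex variable and its conjugate *)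

Section conjugate_polynomials.
Variable R : realType.
Implicit Types (q : R[i] -> R[i]).
Local Open Scope nat_scope.

(** Polynomial functions of [z] and its conjugate of total degree at most [D],
    as explicit lists of monomials [c * z ^+ i * z^* ^+ j]. The bound on the
    degree is tracked because trigonometric polynomials of degree less than [M]
    cannot distinguish the circle from the [M]-th roots of unity. *)
Definition zpoly D q := exists2 s : seq (R[i] * (nat * nat)),
  all (fun t => t.2.1 + t.2.2 <= D) s &
  forall z, q z = (\sum_(t <- s) t.1 * z ^+ t.2.1 * (z^*)%R ^+ t.2.2)%R.

Lemma zpolyW D D' q : D <= D' -> zpoly D q -> zpoly D' q.
Proof.
move=> DD' [s sD qE]; exists s => //.
by apply: sub_all sD => t /leq_trans; apply.
Qed.

Lemma zpoly_monom c i j :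
  zpoly (i + j) (fun z => (c * z ^+ i * (z^*)%R ^+ j)%R).
Proof.
exists [:: (c, (i, j))]; first by rewrite /= leqnn.
by move=> z; rewrite big_seq1.
Qed.

Lemma zpoly_eq D q q' : q =1 q' -> zpoly D q -> zpoly D q'.
Proof. by move=> qq' [s sD qE]; exists s => // z; rewrite -qq'. Qed.

Lemma zpoly_cst c : zpoly 0 (fun=> c).
Proof.
by apply: zpoly_eq (zpoly_monom c 0 0) => z; rewrite !expr0 !mulr1.
Qed.

Lemma zpolyD D p q : zpoly D p -> zpoly D q -> zpoly D (fun z => (p z + q z)%R).
Proof.
move=> [s sD pE] [t tD qE]; exists (s ++ t); first by rewrite all_cat sD.
by move=> z; rewrite big_cat pE qE.
Qed.

Lemma zpolyM D D' p q :
  zpoly D p -> zpoly D' q -> zpoly (D + D') (fun z => (p z * q z)%R).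
Proof.
move=> [s sD pE] [t tD qE].
exists [seq ((a.1 * b.1)%R, (a.2.1 + b.2.1, a.2.2 + b.2.2)) | a <- s, b <- t].
  apply/allP => _ /allpairsP[[a b] /= [ain bin ->]] /=.
  by rewrite addnACA leq_add// ?(allP sD)// ?(allP tD).
move=> z; rewrite pE qE big_allpairs_dep mulr_suml; apply: eq_bigr => a _.
rewrite mulr_sumr; apply: eq_bigr => b _ /=.
by rewrite !exprD [LHS]mulrACA [in LHS](mulrACA a.1).
Qed.

Lemma zpoly_exp D q i : zpoly D q -> zpoly (D * i) (fun z => (q z ^+ i)%R).
Proof.
move=> qP; elim: i => [|i IH].
  by rewrite muln0; apply: zpoly_eq (zpoly_cst 1%R) => z; rewrite expr0.
rewrite mulnS; apply: zpoly_eq (zpolyM qP IH) => z.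
by rewrite exprS.
Qed.

Lemma zpoly_sum D (I : eqType) (s : seq I) (F : I -> R[i] -> R[i]) :
  (forall i, i \in s -> zpoly D (F i)) ->
  zpoly D (fun z => (\sum_(i <- s) F i z)%R).
Proof.
elim: s => [|i s IH] FD.
  by apply: zpolyW (zpoly_eq _ (zpoly_cst 0%R)) => // z; rewrite big_nil.
have Fi : zpoly D (F i) by apply: FD; rewrite mem_head.
have Fs : zpoly D (fun z => (\sum_(i <- s) F i z)%R).
  by apply: IH => j js; apply: FD; rewrite in_cons js orbT.
by apply: zpoly_eq (zpolyD Fi Fs) => z; rewrite big_cons.
Qed.

Lemma zpoly_id : zpoly 1 id.
Proof.
by apply: zpoly_eq (zpoly_monom 1%R 1 0) => z; rewrite mul1r expr1 expr0 mulr1.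
Qed.

Lemma zpoly_conj : zpoly 1 (fun z => (z^*)%R).
Proof.
by apply: zpoly_eq (zpoly_monom 1%R 0 1) => z; rewrite mul1r expr1 expr0 mul1r.
Qed.

(** The bound on the degree is kept, which lets the law of a sum be treated by
    conditioning on one of the summands. *)
Lemma zpoly_shift D q w : zpoly D q -> zpoly D (fun z => q (z + w)%R).
Proof.
move=> [s sD qE].
apply: (@zpoly_eq _ (fun z => \sum_(t <- s)
    t.1 * (z + w) ^+ t.2.1 * ((z + w)^*)%R ^+ t.2.2)%R); first by move=> z; rewrite qE.
apply: zpoly_sum => t ts.
have wP c : zpoly 1 (fun=> c) := zpolyW (leqnSn 0) (zpoly_cst c).
have h1 := zpoly_exp t.2.1 (zpolyD zpoly_id (wP w)).
have h2 := zpoly_exp t.2.2 (zpolyD zpoly_conj (wP (w^*)%R)).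
rewrite !mul1n in h1 h2.
apply: zpolyW (allP sD t ts) (zpoly_eq _ (zpolyM (zpoly_cst t.1) (zpolyM h1 h2))).
by move=> z; rewrite mulrA rmorphD.
Qed.

Lemma zpoly_Re : zpoly 1 (fun z => (complex.Re z)%:C%C).
Proof.
apply: zpoly_eq (zpolyD (zpoly_monom (2^-1)%R 1 0) (zpoly_monom (2^-1)%R 0 1)) => z.
rewrite !expr0 !mulr1 !expr1 -mulrDr.
by case: z => a b; apply/eqP; rewrite eq_complex /=; apply/andP; split; apply/eqP; simpc; rewrite /=; field.
Qed.

Lemma zpoly_Im : zpoly 1 (fun z => (complex.Im z)%:C%C).
Proof.
apply: zpoly_eq (zpolyD (zpoly_monom (- 'i / 2)%R 1 0) (zpoly_monom ('i / 2)%R 0 1)) => z.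
rewrite !expr0 !mulr1 !expr1.
by case: z => a b; apply/eqP; rewrite eq_complex /=; apply/andP; split; apply/eqP; simpc; rewrite /=; field.
Qed.

End conjugate_polynomials.

(** * Bernstein operators and uniform approximation on a square *)

Section bernstein.
Variable R : realType.
Implicit Types (t : R) (F H : nat -> R).

(** The Bernstein operator, i.e. the mean of [F] under the binomial law of
    parameters [n] and [t], defined by conditioning on one trial; this makes the
    variance formula and polynomiality immediate inductions. *)
Fixpoint bern n t F : R :=
  if n is m.+1 then t * bern m t (fun k => F k.+1) + (1 - t) * bern m t F else F 0%N.

Lemma bern_le n t F H : 0 <= t <= 1 -> (forall k, (k <= n)%N -> F k <= H k) ->
  bern n t F <= bern n t H.
Proof.
move=> /andP[t0 t1]; elim: n F H => [|n IH] F H FH /=; first exact: FH.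
apply: lerD.
  by apply: ler_wpM2l => //; apply: IH => k kn; exact: FH.
by apply: ler_wpM2l; [lra | apply: IH => k kn; apply: FH; exact: leqW].
Qed.

Lemma bern_lin n t a F b H :
  bern n t (fun k => a * F k + b * H k) = a * bern n t F + b * bern n t H.
Proof. by elim: n F H => [//|n IH] F H /=; rewrite !IH; ring. Qed.

Lemma bern_cst n t a : bern n t (fun=> a) = a.
Proof. by elim: n => [//|n IH] /=; rewrite IH; ring. Qed.

Lemma eq_bern n t F H : F =1 H -> bern n t F = bern n t H.
Proof. by move=> FH; congr bern; apply/funext. Qed.

Lemma bern_sqr n t c :
  bern n t (fun k => (k%:R - c) ^+ 2) = (n%:R * t - c) ^+ 2 + n%:R * (t * (1 - t)).
Proof.
elim: n c => [|n IH] c /=; first by rewrite !mul0r addr0.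
rewrite IH (@eq_bern _ _ _ (fun k => (k%:R - (c - 1)) ^+ 2)).
  by rewrite IH -natr1; ring.
by move=> k; rewrite -natr1; congr (_ ^+ 2); ring.
Qed.

Lemma bern_dist n t F H x : 0 <= t <= 1 -> (forall k, `|F k - x| <= H k) ->
  `|bern n t F - x| <= bern n t H.
Proof.
move=> t01 FH; have FH' k : x - H k <= F k <= x + H k by rewrite -ler_distl.
rewrite ler_distl -[in X in X && _](bern_cst n t x) -[in X in _ && X](bern_cst n t x).
have lin a : bern n t (fun=> x) + a * bern n t H = bern n t (fun k => x + a * H k).
  rewrite -[bern n t (fun=> x)]mul1r -bern_lin; apply: eq_bern => k.
  by rewrite mul1r.
rewrite -mulN1r lin -[bern n t H in X in _ && X]mul1r lin.
by apply/andP; split; apply: bern_le => // k _; have /andP[] := FH' k;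
  rewrite ?mulN1r ?mul1r.
Qed.

Lemma zpoly_bern D n (u : R[i] -> R) (F : R[i] -> nat -> R) :
  zpoly 1 (fun z => (u z)%:C%C) ->
  (forall k, zpoly D (fun z => (F z k)%:C%C)) ->
  zpoly (n + D) (fun z => (bern n (u z) (F z))%:C%C).
Proof.
move=> uP; elim: n F => [|n IH] F FP /=; first exact: FP.
have vP : zpoly 1 (fun z => (1 - u z)%:C%C).
  apply: zpoly_eq (zpolyD (zpolyW (leqnSn 0) (zpoly_cst 1))
     (zpolyM (zpoly_cst (-1)) uP)) => z.
  by rewrite mulN1r rmorphB rmorph1.
rewrite -[X in zpoly X]/(1 + (n + D))%N.
apply: zpoly_eq (zpolyD (zpolyM uP (IH (fun z k => F z k.+1) _)) (zpolyM vP (IH F _))) => //.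
by move=> z; rewrite -!rmorphM -rmorphD.
Qed.

End bernstein.

Section weierstrass.
Variables (R : realType) (f : Cplane R -> R).
Hypothesis f_cont : continuous f.
Local Open Scope classical_set_scope.

Let h (v : R * R) : R := f (v.1 +i* v.2)%C.

Let h_cont : continuous h.
Proof.
move=> v A /f_cont /nbhs_ballP[e /= e0 eA].
have [r er] : exists r : R, e = r%:C%C by apply/complex_realP; rewrite gtr0_real.
have r0 : 0 < r by rewrite er ltcR in e0.
apply/nbhs_ballP; exists (r / 2) => /=; first by rewrite divr_gt0.
move=> w [/= w1 w2]; apply: eA; rewrite /ball/= er.
apply: le_lt_trans (norm_le_ReIm _) _; rewrite ltcR !raddfB/=.
by rewrite [ltRHS]splitr ltrD.
Qed.

(** By compactness of the square, through near coverings. *)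
Lemma square_unif_continuous (r e : R) : 0 < e -> exists2 del, 0 < del &
  forall a b a' b', `|a| <= r -> `|b| <= r -> `|a - a'| < del -> `|b - b'| < del ->
    `|f (a +i* b)%C - f (a' +i* b')%C| < e.
Proof.
move=> e0; have e2 : 0 < e / 2 by rewrite divr_gt0.
have /compact_near_coveringP K : compact (`[- r, r]%classic `*` `[- r, r]%classic : set (R * R)).
  by apply: compact_setX; exact: segment_compact.
pose P (n : nat) (v : R * R) := forall w : R * R,
  `|v.1 - w.1| < n.+1%:R^-1 -> `|v.2 - w.2| < n.+1%:R^-1 -> `|h v - h w| < e.
have [|n _ nP] := K nat \oo P _.
  move=> v _; have /nbhs_ballP[d /= d0 dP] : nbhs v [set w | `|h v - h w| < e / 2].
    exact: (h_cont (nbhsx_ballx (h v) _ e2)).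
  have d2 : 0 < d / 2 by rewrite divr_gt0.
  exists (ball v (d / 2), [set n | n.+1%:R^-1 < d / 2]) => /=.
    split; first exact: nbhsx_ballx.
    exact: near_infty_natSinv_lt (PosNum d2).
  move=> [v' n] [/= [v'1 v'2] nd] w w1 w2.
  have vv' : `|h v - h v'| < e / 2.
    by apply: dP; apply: le_ball (_ : d / 2 <= d) _ _; [lra | split].
  have vw : `|h v - h w| < e / 2.
    apply: dP; rewrite [d]splitr; split => /=.
      by apply: ball_triangle v'1 _; rewrite /ball/= (lt_trans w1).
    by apply: ball_triangle v'2 _; rewrite /ball/= (lt_trans w2).
  rewrite -(subrKA (h v)) (le_lt_trans (ler_normD _ _))// [e]splitr ltrD//.
  by rewrite distrC.
exists n.+1%:R^-1; first by rewrite invr_gt0.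
move=> a b a' b' ar br aa bb; apply: (nP n _ (a, b) _ (a', b')) => //=.
by split; rewrite /= in_itv/= -ler_norml.
Qed.

Variable M : R.
Hypothesis f_bound : forall z, `|f z| <= M.

(** Points at distance at least [del] are handled by the bound [M], nearby points
    by uniform continuity. The quadratic form of the estimate is the one that the
    variance of the binomial law controls. *)
Lemma square_quadratic_modulus (r e : R) : 0 < e -> exists2 K, 0 <= K &
  forall a b a' b', `|a| <= r -> `|b| <= r ->
    `|f (a' +i* b')%C - f (a +i* b)%C| <= e + K * ((a' - a) ^+ 2 + (b' - b) ^+ 2).
Proof.
move=> e0; have [del del0 delP] := square_unif_continuous r e0.
have M0 : 0 <= M := le_trans (normr_ge0 _) (f_bound 0).
have K0 : 0 <= 2 * M / del ^+ 2.
  by apply: divr_ge0; [exact: mulr_ge0 | exact: sqr_ge0].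
exists (2 * M / del ^+ 2) => //.
move=> a b a' b' ar br.
have sq (x y : R) : 0 <= (x - y) ^+ 2 by exact: sqr_ge0.
have big (x y : R) : del <= `|x - y| -> del ^+ 2 <= (y - x) ^+ 2.
  by move=> xy; rewrite -[leRHS]real_normK ?num_real// distrC ler_pXn2r// nnegrE ltW.
have far : del ^+ 2 <= (a' - a) ^+ 2 + (b' - b) ^+ 2 ->
    `|f (a' +i* b')%C - f (a +i* b)%C| <=
    e + 2 * M / del ^+ 2 * ((a' - a) ^+ 2 + (b' - b) ^+ 2).
  move=> dd; apply: (@le_trans _ _ (2 * M)).
    by apply: le_trans (ler_normB _ _) _; rewrite mulr2n mulrDl !mul1r lerD.
  apply: ler_wpDl; first exact: ltW.
  by rewrite mulrAC ler_pdivlMr ?exprn_gt0// ler_wpM2l// mulr_ge0.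
have [aa|aa] := ltP `|a - a'| del; last first.
  by apply: far; apply: ler_wpDr => //; exact: big.
have [bb|bb] := ltP `|b - b'| del; last first.
  by apply: far; apply: ler_wpDl => //; exact: big.
rewrite distrC; apply: ler_wpDr; last exact/ltW/delP.
by rewrite mulr_ge0// addr_ge0.
Qed.

(** The Weierstrass theorem on the square of half-side [r], by the tensor product
    of two Bernstein operators evaluated at [s = (x + r) / (2 * r)]. *)
Lemma zpoly_approx (r e : R) : 0 < r -> 0 < e -> exists D, exists2 p : R[i] -> R,
  zpoly D (fun z => (p z)%:C%C) &
  forall z, `|complex.Re z| <= r -> `|complex.Im z| <= r -> `|f z - p z| <= e.
Proof.
move=> r0 e0; have [K K0 KP] := square_quadratic_modulus r (divr_gt0 e0 (ltr0Sn R 1)).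
pose L := K * (2 * r) ^+ 2.
have L0 : 0 <= L by rewrite mulr_ge0 ?sqr_ge0.
(* [n] is large enough for the two variance terms, at most [L / n] each, to add
   up to at most [e / 2] *)
pose m := Num.truncn (4 * L / e); pose n := m.+1.
have n0 : 0 < n%:R :> R by rewrite ltr0n.
have nL : L / n%:R <= e / 4.
  have : 4 * L / e < n%:R by rewrite /n truncnS_gt.
  rewrite ltr_pdivrMr// => nL; rewrite ler_pdivrMr//; lra.
pose s (a : R) := (a + r) / (2 * r).
pose g k : R := r * (2 * (k%:R / n%:R) - 1).
exists (n + (n + 0))%N, (fun z => bern n (s (complex.Re z))
   (fun i => bern n (s (complex.Im z)) (fun j => f (g i +i* g j)%C))).
  have sP (u : R[i] -> R) : zpoly 1 (fun z => (u z)%:C%C) ->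
      zpoly 1 (fun z => (s (u z))%:C%C).
    move=> uP; have r'P : zpoly 1 (fun=> r%:C%C) := zpolyW (leqnSn 0) (zpoly_cst _).
    apply: zpoly_eq (zpolyM (zpolyD uP r'P) (zpoly_cst ((2 * r)^-1)%:C%C)) => z.
    by rewrite -rmorphD -rmorphM.
  apply: zpoly_bern => [|i]; first exact/sP/zpoly_Re.
  apply: zpoly_bern => [|j]; first exact/sP/zpoly_Im.
  exact: zpoly_cst.
move=> z; set a := complex.Re z; set b := complex.Im z => ar br.
have -> : f z = f (a +i* b)%C by rewrite /a /b; case: (z).
have s01 c : `|c| <= r -> 0 <= s c <= 1.
  rewrite ler_norml => /andP[c1 c2]; rewrite /s ler_pdivlMr ?ler_pdivrMr ?mulr_gt0//.
  by apply/andP; split; lra.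
have gs i c : g i - c = 2 * r / n%:R * (i%:R - n%:R * s c).
  by rewrite /g /s; field; rewrite !gt_eqF.
pose V c i : R := L / n%:R ^+ 2 * (i%:R - n%:R * s c) ^+ 2.
have VE i c : K * (g i - c) ^+ 2 = V c i.
  by rewrite gs /V /L; field; rewrite gt_eqF.
have point i j : `|f (g i +i* g j)%C - f (a +i* b)%C| <= e / 2 + V a i + V b j.
  by apply: le_trans (KP _ _ _ _ ar br) _; rewrite mulrDr !VE addrA.
have Vbern c x : `|c| <= r -> bern n (s c) (fun i => x + V c i) <= x + L / n%:R.
  move=> cr; have -> : (fun i => x + V c i) =
      (fun i => x * 1 + L / n%:R ^+ 2 * (i%:R - n%:R * s c) ^+ 2).
    by apply/funext => i; rewrite mulr1.
  rewrite (bern_lin n (s c) x (fun=> 1)) bern_cst bern_sqr subrr expr0n add0r mulr1.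
  rewrite lerD2l (_ : _ * (n%:R * _) = L / n%:R * (s c * (1 - s c))); last first.
    by field; rewrite gt_eqF.
  rewrite -[leRHS]mulr1 ler_wpM2l ?divr_ge0// ?(ltW n0)//.
  by have /andP[] := s01 c cr; nra.
rewrite distrC; apply: (@le_trans _ _ (e / 2 + L / n%:R + L / n%:R)); last by lra.
apply: le_trans (Vbern _ _ ar).
apply: bern_dist; first exact: s01.
move=> i; rewrite -[leRHS]/(e / 2 + L / n%:R + V a i) (addrAC (e / 2)).
apply: le_trans (Vbern _ _ br).
apply: bern_dist; first exact: s01.
by move=> j; exact: point.
Qed.

End weierstrass.

(** * Moments of sums of roots of unity *)

Section roots_of_unity.
Variable R : realType.
Implicit Types (x y : R) (z : R[i]).

Lemma expiD x y : (expi (x + y) : R[i]) = (expi x : R[i]) * (expi y : R[i]).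
Proof. by rewrite /expi cosD sinD; simpc; congr (_ +i* _)%C; ring. Qed.

Lemma expi0 : (expi (0 : R) : R[i]) = 1.
Proof. by rewrite /expi cos0 sin0. Qed.

Lemma expi_natmul x n : (expi (x * n%:R) : R[i]) = (expi x : R[i]) ^+ n.
Proof.
elim: n => [|n IH]; first by rewrite mulr0 expr0 expi0.
by rewrite -natr1 mulrDr mulr1 expiD IH exprSr.
Qed.

Lemma expi_conj x : ((expi x : R[i])^*)%R = expi (- x).
Proof. by rewrite /expi cosN sinN. Qed.

Lemma expi_mul_conj x : (expi x : R[i]) * ((expi x : R[i])^*)%R = 1.
Proof. by rewrite expi_conj -expiD subrr expi0. Qed.

Lemma expi_2pi : (expi (2 * pi : R) : R[i]) = 1.
Proof.
have -> : (2 * pi : R) = pi + pi by rewrite mulr_natl mulr2n.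
rewrite expiD (_ : expi pi = -1 :> R[i]) ?mulrNN ?mulr1//.
by apply/eqP; rewrite /expi cospi sinpi eq_complex/= oppr0 !eqxx.
Qed.

Lemma expi_neq1 x : 0 < x < 2 * pi -> (expi x : R[i]) != 1.
Proof.
move=> /andP[x0 x2]; apply/negP => /eqP[cx _].
have sx : 0 < sin (x / 2).
  by apply: sin_gt0_pi; rewrite divr_gt0//= ltr_pdivrMr// mulrC.
have : cos x = 1 - 2 * sin (x / 2) ^+ 2.
  rewrite [in LHS](splitr x) cosD -!expr2 cos2sin2; ring.
rewrite cx; have := exprn_gt0 2 sx; lra.
Qed.

Variables (M : nat) (M_gt0 : (0 < M)%N).

Let w : R[i] := expi (2 * pi / M%:R : R).

Let M0 : M%:R != 0 :> R.
Proof. by rewrite pnatr_eq0 -lt0n. Qed.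

Let w_exp n : w ^+ n = expi (2 * pi * n%:R / M%:R).
Proof. by rewrite /w -expi_natmul mulrAC. Qed.

Let w_expM : w ^+ M = 1.
Proof. by rewrite w_exp mulfK// expi_2pi. Qed.

Let w_exp_eq1 n : (w ^+ n == 1) = (M %| n)%N.
Proof.
rewrite {1}(divn_eq n M) exprD mulnC exprM w_expM expr1n mul1r.
apply/eqP/idP => [wn|/eqP ->]; last by rewrite expr0.
rewrite /dvdn; apply: contraPT wn => r0; rewrite w_exp.
apply/eqP/expi_neq1; rewrite divr_gt0 ?ltr0n// ?mulr_gt0 ?pi_gt0 ?ltr0n ?lt0n//=.
rewrite ltr_pdivrMr ?ltr0n// ltr_pM2l ?mulr_gt0 ?pi_gt0//.
by rewrite ltr_nat ltn_mod.
Qed.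

Definition unity_root (j : 'I_M) : R[i] := expi (2 * pi * j.+1%:R / M%:R : R).

Let sum_unity_root_exp n :
  \sum_j unity_root j ^+ n = M%:R * (M %| n)%:R.
Proof.
rewrite (eq_bigr (fun j : 'I_M => (w ^+ n) ^+ j.+1)); last first.
  by move=> j _; rewrite /unity_root -w_exp -!exprM mulnC.
rewrite -w_exp_eq1; case: eqP => [->|/eqP wn].
  rewrite (eq_bigr (fun=> 1)) => [|j _]; last by rewrite expr1n.
  by rewrite sumr_const card_ord mulr1.
rewrite mulr0; have : (w ^+ n - 1) * \sum_(j < M) (w ^+ n) ^+ j = 0.
  by rewrite -subrX1 -exprM mulnC exprM w_expM expr1n subrr.
move/eqP; rewrite mulf_eq0 subr_eq0 (negPf wn)/= => /eqP S0.
under eq_bigr do rewrite exprS.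
by rewrite -mulr_sumr S0 mulr0.
Qed.

(** A geometric sum, once the conjugate of a root of unity is seen as its
    inverse. *)
Lemma sum_unity_root_monom a b :
  \sum_j unity_root j ^+ a * ((unity_root j)^*)%R ^+ b =
  M%:R * (M %| `|a%:Z - b%:Z|)%:R :> R[i].
Proof.
have uK j : unity_root j * ((unity_root j)^*)%R = 1 := expi_mul_conj _.
have [ab|/ltnW ab] := leqP b a.
  rewrite distnEl// -sum_unity_root_exp; apply: eq_bigr => j _.
  by rewrite -{1}(subnK ab) exprD -mulrA -exprMn uK expr1n mulr1.
rewrite distnEr// -[RHS]conjCK.
rewrite rmorphM !rmorph_nat -sum_unity_root_exp rmorph_sum.
apply: eq_bigr => j _.
by rewrite -{1}(subnK ab) exprD mulrCA -exprMn uK expr1n mulr1 rmorphXn.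
Qed.

(** Expand both powers into words. The contribution of a pair of words is a
    product over the letters [k] of sums over one root of unity, nonzero exactly
    when the two counts of [k] are congruent modulo [M]. *)
Lemma sum_ffun_unity_roots d a b :
  \sum_(f : {ffun 'I_d -> 'I_M}) (\sum_k unity_root (f k)) ^+ a *
     ((\sum_k unity_root (f k))^*)%R ^+ b =
  M%:R ^+ d * (coinc_lim d M a b)%:R.
Proof.
have expand n (z : 'I_d -> R[i]) : (\sum_k z k) ^+ n =
    \sum_(u : {ffun 'I_n -> 'I_d}) \prod_k z k ^+ occ u k.
  rewrite -[X in _ ^+ X](card_ord n) -prodr_const bigA_distr_bigA.
  apply: eq_bigr => u _; rewrite (partition_big u predT)//=.
  apply: eq_bigr => k _; rewrite -prodr_const.
  by apply: eq_bigr => i /eqP ->.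
transitivity (\sum_(f : {ffun 'I_d -> 'I_M}) \sum_(fg : {ffun 'I_a -> 'I_d} * {ffun 'I_b -> 'I_d})
    \prod_k (unity_root (f k) ^+ occ fg.1 k * ((unity_root (f k))^*)%R ^+ occ fg.2 k)).
  apply: eq_bigr => f _; rewrite rmorph_sum !expand mulr_suml.
  under eq_bigr do rewrite mulr_sumr.
  by rewrite pair_big/=; apply: eq_bigr => fg _; rewrite big_split.
rewrite exchange_big/= /coinc_lim -sum1_card natr_sum mulr_sumr [RHS]big_mkcond/=.
apply: eq_bigr => fg _.
rewrite -(bigA_distr_bigA (fun k j =>
  unity_root j ^+ occ fg.1 k * ((unity_root j)^*)%R ^+ occ fg.2 k)).
under eq_bigr do rewrite sum_unity_root_monom.
rewrite big_split/= prodr_const card_ord mulr1 inE.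
case: ifP => [/forallP fgM|/negbT/forallPn[k kM]].
  by rewrite big1 ?mulr1// => k _; have := fgM k; rewrite ffunE => ->.
by rewrite (bigD1 k)//=; move: kM; rewrite ffunE => /negPf ->; rewrite mul0r mulr0.
Qed.

End roots_of_unity.

(** * Integrals against concentrated and empirical measures *)

Section concentrated_integrals.
Context d (T : measurableType d) (R : realType) (mu : probability T R) (K : set T).
Hypotheses (mK : measurable K) (K_full : mu (~` K)%classic = 0%E).
Implicit Types f g : T -> R.
Local Open Scope classical_set_scope.

Definition bounded_in f := exists B : R, forall x, K x -> `|f x| <= B.

Lemma integrable_concentrated f :
  measurable_fun setT f -> bounded_in f -> mu.-integrable setT (EFin \o f).
Proof.
move=> mf [B fB]; apply/(negligible_integrable (measurableC mK) measurableT _ K_full).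
  exact/measurable_EFinP.
rewrite setTD setCK; apply: measurable_bounded_integrable => //.
- by rewrite (le_lt_trans (probability_le1 _ _))// ltry.
- exact: measurable_funTS.
- exists B; split; first exact: num_real.
  by move=> x Bx y Ky; apply: le_trans (fB y Ky) (ltW Bx).
Qed.

Lemma Rintegral_concentrated f : measurable_fun setT f -> bounded_in f ->
  \int[mu]_x f x = \int[mu]_(x in K) f x.
Proof.
move=> mf fB; rewrite /Rintegral.
rewrite (negligible_integral (measurableC mK) measurableT _ K_full).
  by rewrite setTD setCK.
exact: integrable_concentrated.
Qed.

Let integrableK f : measurable_fun setT f -> bounded_in f ->
  mu.-integrable K (EFin \o f).
Proof.
move=> mf fB; apply: (integrableS measurableT) => //.
exact: integrable_concentrated.
Qed.

Lemma Rintegral_dist_le f g (e : R) : measurable_fun setT f -> bounded_in f ->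
  measurable_fun setT g -> bounded_in g ->
  (forall x, K x -> `|f x - g x| <= e) ->
  `|\int[mu]_x f x - \int[mu]_x g x| <= e.
Proof.
move=> mf fB mg gB fg; rewrite !Rintegral_concentrated// -RintegralB//; last 2 first.
- exact: integrableK.
- exact: integrableK.
have mfg : measurable_fun setT (f \- g) by exact: measurable_funB.
have fgB : bounded_in (f \- g) by exists e.
apply: le_trans (le_normr_Rintegral mK (integrableK mfg fgB)) _.
apply: (@le_trans _ _ (\int[mu]_(x in K) e)).
  apply: le_Rintegral => //.
  - apply: (@integrableK (fun x => `|f x - g x|)); last first.
      by exists e => x Kx; rewrite normr_id fg.
    by apply: measurableT_comp.
  - apply: (@integrableK (fun=> e)); first exact: measurable_cst.
    by exists `|e|.
rewrite Rintegral_cst// (_ : fine _ = 1) ?mulr1//.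
have muK : mu K = 1%E.
  by rewrite -[K]setCK probability_setC ?K_full ?sube0//; exact: measurableC.
by rewrite -[X in fine X]/(mu K) muK.
Qed.

End concentrated_integrals.

Section empirical_integrals.
Context d (T : measurableType d) (R : realType).
Variables (s : seq T) (s_neq0 : s != [::]).
Local Open Scope ereal_scope.

Let ge0_integral_empirical (f : T -> R) : measurable_fun setT f ->
  (forall x, (0 <= f x)%R) ->
  \int[empirical R s_neq0]_x (f x)%:E =
  (((size s)%:R^-1 * \sum_(x <- s) f x)%R)%:E.
Proof.
move=> mf f0; case: s s_neq0 => [//|x0 s'] t_neq0.
have r_ge0 : (0 <= (size (x0 :: s'))%:R^-1 :> R)%R by rewrite invr_ge0.
rewrite (eq_measure_integral (mscale (NngNum r_ge0)
    (msum (fun k => \d_(nth x0 (x0 :: s') k)) (size (x0 :: s'))))); last first.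
  by move=> A _ _; rewrite /= /empirical /mscale/= /msum (big_nth x0) big_mkord.
have mE : measurable_fun setT (EFin \o f) by exact/measurable_EFinP.
rewrite ge0_integral_mscale//; last by move=> x _; rewrite lee_fin.
rewrite ge0_integral_measure_sum//; last by move=> x _; rewrite lee_fin.
rewrite EFinM; congr (_ * _).
rewrite (big_nth x0) big_mkord -sumEFin; apply: eq_bigr => k _.
by rewrite integral_dirac// diracT mul1e.
Qed.

Lemma Rintegral_empirical (f : T -> R) : measurable_fun setT f ->
  (\int[empirical R s_neq0]_x f x = (size s)%:R^-1 * \sum_(x <- s) f x)%R.
Proof.
move=> mf; rewrite /Rintegral integralE.
have pE : (EFin \o f)^\+ = EFin \o (fun x => Num.max (f x) 0%R).
  by apply/funext => x; rewrite funeposE /= EFin_max.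
have nE : (EFin \o f)^\- = EFin \o (fun x => Num.max (- f x)%R 0%R).
  by apply/funext => x; rewrite funenegE /= EFin_max.
rewrite pE nE !ge0_integral_empirical; last 4 first.
- by apply: measurable_maxr => //; exact: measurable_funN.
- by move=> x; rewrite le_max lexx orbT.
- exact: measurable_maxr.
- by move=> x; rewrite le_max lexx orbT.
rewrite -EFinB/= -mulrBr -sumrB; congr (_ * _)%R; apply: eq_bigr => x _.
by case: (leP (f x) 0%R); case: (leP (- f x)%R 0%R); lra.
Qed.

Lemma empirical_full (K : set T) : measurable K -> (forall x, x \in s -> K x) ->
  empirical R s_neq0 (~` K)%classic = 0.
Proof.
move=> mK sK; rewrite /= /empirical big_seq big1 ?mule0// => x xs.
by rewrite diracE memNset//= => /(_ (sK x xs)).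
Qed.

End empirical_integrals.

(** * Integrals of polynomials against convolution powers *)

Lemma sum_ffun_recl (V : nmodType) d (J : finType) (F : {ffun 'I_d.+1 -> J} -> V) :
  \sum_f F f =
  \sum_j \sum_(g : {ffun 'I_d -> J}) F [ffun k => oapp g j (unlift ord0 k)].
Proof.
rewrite pair_big/= (reindex (fun jg : J * {ffun 'I_d -> J} =>
  [ffun k => oapp jg.2 jg.1 (unlift ord0 k)])) //=.
exists (fun f => (f ord0, [ffun k => f (lift ord0 k)])).
  move=> [j g] _; rewrite ffunE unlift_none; congr pair.
  by apply/ffunP => k; rewrite !ffunE liftK.
move=> f _; apply/ffunP => k; rewrite ffunE.
by case: unliftP => [l ->|->] /=; rewrite ?ffunE.
Qed.

Lemma Rintegral_sum (R : realType) d (T : measurableType d) (mu : measure T R)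
    (I : Type) (s : seq I) (f : I -> T -> R) :
  (forall i, mu.-integrable setT (EFin \o f i)) ->
  \int[mu]_x (\sum_(i <- s) f i x) = \sum_(i <- s) \int[mu]_x f i x.
Proof.
move=> intf; elim: s => [|i s IH].
  rewrite big_nil; under eq_fun do rewrite big_nil.
  by rewrite Rintegral_cst// mul0r.
rewrite big_cons -IH -RintegralD//; first by under eq_fun do rewrite big_cons.
rewrite (_ : _ \o _ = fun x => (\sum_(i <- s) (f i x)%:E)%E).
  by apply: integrable_sum => // j _; exact: intf.
by apply/funext => x; rewrite /= sumEFin.
Qed.

Section squares.
Variable R : realType.
Local Notation plane := (borel (Cplane R)).
Implicit Types (r : R) (z : Cplane R).
Local Open Scope classical_set_scope.

(** Squares rather than discs, since they are stable under sums and suit the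
    Bernstein approximation. *)
Definition square r : set plane :=
  [set z : Cplane R | `|complex.Re z| <= r /\ `|complex.Im z| <= r].

Lemma measurable_Re : measurable_fun setT (fun z : plane => complex.Re (z : R[i])).
Proof. exact: continuous_borel_measurable (@Re_continuous R). Qed.

Lemma measurable_Im : measurable_fun setT (fun z : plane => complex.Im (z : R[i])).
Proof. exact: continuous_borel_measurable (@Im_continuous R). Qed.

Lemma measurable_square r : measurable (square r).
Proof.
have band (g : plane -> R) : measurable_fun setT g ->
    measurable [set t | `|g t| <= r].
  move=> mg; have mgr : measurable_fun setT (fun t => `|g t| <= r).
    by apply: measurable_fun_ler => //; exact: measurableT_comp.
  by have := mgr measurableT [set true]; rewrite setTI; apply.
by apply: measurableI; apply: band; [exact: measurable_Re|exact: measurable_Im].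
Qed.

Lemma squareD r s z w : square r z -> square s w -> square (r + s) (z + w).
Proof.
move=> [z1 z2] [w1 w2]; rewrite /square/= !raddfD/=.
by split; apply: le_trans (ler_normD _ _) _; exact: lerD.
Qed.

Lemma norm_le_square (z : R[i]) r : `|z| <= r%:C%C -> square r z.
Proof.
move=> zr; have r0 : 0 <= r by rewrite -ler0c (le_trans _ zr).
have sq : complex.Re z ^+ 2 + complex.Im z ^+ 2 <= r ^+ 2.
  move: zr; rewrite normc_def lecR => zr.
  rewrite -(@sqr_sqrtr _ (complex.Re z ^+ 2 + _)) ?addr_ge0 ?sqr_ge0//.
  by rewrite ler_pXn2r// nnegrE sqrtr_ge0.
have abs (x y : R) : x ^+ 2 + y ^+ 2 <= r ^+ 2 -> `|x| <= r.
  move=> xy; rewrite -(@ler_pXn2r _ 2)// ?nnegrE// real_normK ?num_real//.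
  by apply: le_trans xy; rewrite lerDl sqr_ge0.
by split; [exact: abs sq | rewrite addrC in sq; exact: abs sq].
Qed.

Definition real_zpoly D (p : Cplane R -> R) := zpoly D (fun z => (p z)%:C%C).

Lemma real_zpoly_shift D p w : real_zpoly D p -> real_zpoly D (fun z => p (z + w)).
Proof. exact: zpoly_shift. Qed.

(* Measurability and boundedness on squares, in a form stable under the ring
   operations. *)
Let tame (q : R[i] -> R[i]) :=
  [/\ measurable_fun setT (fun z : plane => complex.Re (q z)),
      measurable_fun setT (fun z : plane => complex.Im (q z)) &
      forall r, exists B : R, forall z, square r z -> `|q z| <= B%:C%C].

Let tame_cst c : tame (fun=> c).
Proof.
split; [exact: measurable_cst|exact: measurable_cst|].
move=> r; exists (complex.Re `|c|) => z _.
by rewrite normc_def.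
Qed.

Let tameM q q' : tame q -> tame q' -> tame (fun z => q z * q' z).
Proof.
move=> [m1 m2 b] [m1' m2' b']; split.
- rewrite (_ : (fun z => _) = (fun z : plane => complex.Re (q z) * complex.Re (q' z)
      - complex.Im (q z) * complex.Im (q' z))); last first.
    by apply/funext => z; case: (q z) (q' z) => [? ?] [? ?].
  by apply: measurable_funB; exact: measurable_funM.
- rewrite (_ : (fun z => _) = (fun z : plane => complex.Re (q z) * complex.Im (q' z)
      + complex.Im (q z) * complex.Re (q' z))); last first.
    by apply/funext => z; case: (q z) (q' z) => [? ?] [? ?].
  by apply: measurable_funD; exact: measurable_funM.
- move=> r; have [B BP] := b r; have [B' BP'] := b' r; exists (B * B') => z zr.
  by rewrite normrM rmorphM ler_pM// ?BP ?BP'.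
Qed.

Let tameD q q' : tame q -> tame q' -> tame (fun z => q z + q' z).
Proof.
move=> [m1 m2 b] [m1' m2' b']; split.
- rewrite (_ : (fun z => _) = (fun z : plane => complex.Re (q z) + complex.Re (q' z))).
    exact: measurable_funD.
  by apply/funext => z; rewrite raddfD.
- rewrite (_ : (fun z => _) = (fun z : plane => complex.Im (q z) + complex.Im (q' z))).
    exact: measurable_funD.
  by apply/funext => z; rewrite raddfD.
- move=> r; have [B BP] := b r; have [B' BP'] := b' r; exists (B + B') => z zr.
  by rewrite (le_trans (ler_normD _ _))// rmorphD lerD// ?BP ?BP'.
Qed.

Let tameX q n : tame q -> tame (fun z => q z ^+ n).
Proof.
move=> tq; elim: n => [|n IH].
  by under eq_fun do rewrite expr0; exact: tame_cst.
by under eq_fun do rewrite exprS; exact: tameM.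
Qed.

Let norm_square r z : square r z -> `|z| <= (r + r)%:C%C.
Proof.
move=> [z1 z2]; apply: le_trans (norm_le_ReIm z) _.
by rewrite lecR lerD.
Qed.

Let tame_id : tame id.
Proof.
split; [exact: measurable_Re|exact: measurable_Im|].
by move=> r; exists (r + r) => z; exact: norm_square.
Qed.

Let tame_conj : tame (fun z => (z^*)%R).
Proof.
split.
- rewrite (_ : (fun z => _) = (fun z : plane => complex.Re (z : R[i]))).
    exact: measurable_Re.
  by apply/funext; case.
- rewrite (_ : (fun z => _) = (fun z : plane => - complex.Im (z : R[i]))).
    apply: measurable_funN; exact: measurable_Im.
  by apply/funext; case.
- by move=> r; exists (r + r) => z; rewrite norm_conjC; exact: norm_square.
Qed.

Let tame_zpoly D q : zpoly D q -> tame q.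
Proof.
move=> [s _ qE]; rewrite (_ : q = fun z => \sum_(t <- s)
    t.1 * z ^+ t.2.1 * (z^*)%R ^+ t.2.2); last exact/funext.
elim: s {qE} => [|t s IH].
  by under eq_fun do rewrite big_nil; exact: tame_cst.
under eq_fun do rewrite big_cons; apply: tameD => //.
by apply: tameM; [apply: tameM|]; [exact: tame_cst|exact: tameX|exact: tameX].
Qed.

Lemma real_zpoly_measurable D p : real_zpoly D p -> measurable_fun setT (p : plane -> R).
Proof. by case/tame_zpoly. Qed.

Lemma real_zpoly_bounded D p r : real_zpoly D p -> bounded_in (square r) p.
Proof.
case/tame_zpoly => _ _ /(_ r)[B BP]; exists B => z /BP.
by rewrite normc_def /= expr0n addr0 sqrtr_sqr lecR.
Qed.

Lemma integrable_real_zpoly (mu : probability plane R) D p r :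
  mu (~` square r) = 0%E -> real_zpoly D p -> mu.-integrable setT (EFin \o (p : plane -> R)).
Proof.
move=> mu0 pP; apply: (integrable_concentrated (measurable_square r)) => //.
  exact: real_zpoly_measurable pP.
exact: real_zpoly_bounded pP.
Qed.

Lemma convolution_square (mu nu : probability plane R) r s :
  mu (~` square r) = 0%E -> nu (~` square s) = 0%E ->
  convolution mu nu (~` square (r + s)) = 0%E.
Proof.
move=> mu0 nu0; rewrite /convolution /distribution /pushforward/=.
set A := _ @^-1` _.
have mc (t : R) := measurableC (measurable_square t).
have AE : A `<=` (~` square r `*` setT) `|` (setT `*` ~` square s).
  move=> [z w] /= Azw; have [zr|zr] := pselect (square r z); last by left.
  by right; split=> // ws; apply: Azw; exact: squareD.
apply/eqP; rewrite eq_le measure_ge0 andbT.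
apply: le_trans (le_measure _ _ _ AE) _; rewrite ?inE.
- by rewrite -[A]setTI; apply: measurable_add_borel.
- by apply: measurableU; apply: measurableX.
have mX1 : measurable (~` square r `*` setT : set (plane * plane)) by exact: measurableX.
have mX2 : measurable (setT `*` ~` square s : set (plane * plane)) by exact: measurableX.
apply: (le_trans (measureU2 (mu \x nu)%E mX1 mX2)).
rewrite [X in (X + _)%E](product_measure1E mu nu)//.
rewrite [X in (_ + X)%E](product_measure1E mu nu)//.
by rewrite [X in (X * _ + _)%E]mu0 [X in (_ + _ * X)%E]nu0 mul0e mule0 adde0.
Qed.

(** Fubini's theorem applies because both laws have bounded support, on which
    polynomials are bounded. *)
Lemma Rintegral_convolution (mu nu : probability plane R) r s D p :
  mu (~` square r) = 0%E -> nu (~` square s) = 0%E -> real_zpoly D p ->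
  \int[convolution mu nu]_z p z = \int[nu]_y \int[mu]_x p ((x : Cplane R) + (y : Cplane R)).
Proof.
move=> mu0 nu0 pP; rewrite /Rintegral; congr fine.
have mp := real_zpoly_measurable pP.
have mE : measurable_fun setT (EFin \o (p : plane -> R)) by exact/measurable_EFinP.
have int_add : (mu \x nu)%E.-integrable setT (EFin \o ((p : plane -> R) \o @add_borel R)).
  apply: (@integrable_concentrated _ _ _ (mu \x nu)%E (@add_borel R @^-1` square (r + s))).
  - by rewrite -[X in measurable X]setTI; apply: measurable_add_borel => //; exact: measurable_square.
  - exact: convolution_square mu0 nu0.
  - apply: measurableT_comp => //; exact: measurable_add_borel.
  - have [B BP] := real_zpoly_bounded (r + s) pP; exists B => z; exact: BP.
rewrite integral_distribution//.
rewrite -(integral21_prod_meas1 int_add); apply: eq_integral => y _.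
rewrite /fubini_G/= fineK//; apply: integrable_fin_num => //.
exact: (integrable_real_zpoly mu0 (real_zpoly_shift y pP)).
Qed.

(* A law [eta] that polynomials of degree at most [D] do not distinguish from
   the uniform law on the [M] points [om j]. *)
Variables (M : nat) (om : 'I_M -> Cplane R) (eta : probability plane R) (D : nat).
Hypothesis eta_square : eta (~` square 1) = 0%E.
Hypothesis eta_mean : forall p, real_zpoly D p ->
  \int[eta]_z p z = M%:R^-1 * \sum_j p (om j).

Lemma convolution_pow_square d : convolution_pow eta d (~` square d%:R) = 0%E.
Proof.
elim: d => [|d IH].
  by rewrite /= diracE memNset//=; apply; rewrite /square/= normr0.
by rewrite -natr1 addrC /convolution_pow iterS; exact: convolution_square.
Qed.

(** Integrate over one summand first, the others being fixed: translates of a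
    polynomial keep its degree. *)
Lemma Rintegral_convolution_pow d p : real_zpoly D p ->
  \int[convolution_pow eta d]_z p z =
  M%:R ^- d * \sum_(f : {ffun 'I_d -> 'I_M}) p (\sum_k om (f k)).
Proof.
elim: d p => [|d IH] p pP.
  rewrite /convolution_pow/= expr0 invr1 mul1r (eq_bigr (fun=> p 0)); last first.
    by move=> f _; rewrite big_ord0.
  rewrite sumr_const card_ffun !card_ord expn0 mulr1n /Rintegral.
  rewrite integral_dirac// ?diracT ?mul1e//.
  by apply/measurable_EFinP; exact: real_zpoly_measurable pP.
rewrite /convolution_pow iterS (Rintegral_convolution eta_square (convolution_pow_square d) pP).
rewrite (_ : (fun y => _) = fun y => M%:R^-1 * \sum_j p (om j + y)); last first.
  by apply/funext => y; rewrite (eta_mean (real_zpoly_shift y pP)).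
have shiftP j : real_zpoly D (fun z => p (om j + z)).
  by under eq_fun do rewrite addrC; exact: real_zpoly_shift.
have intj j := integrable_real_zpoly (convolution_pow_square d) (shiftP j).
have ints : (convolution_pow eta d).-integrable setT
    (EFin \o (fun y : plane => \sum_j p (om j + (y : Cplane R)))).
  rewrite (_ : _ \o _ = fun y : plane => (\sum_j (p (om j + (y : Cplane R)))%:E)%E).
    by apply: integrable_sum => // j _; exact: intj.
  by apply/funext => y; rewrite /= sumEFin.
rewrite RintegralZl// Rintegral_sum//.
under eq_bigr do rewrite IH//.
rewrite -mulr_sumr mulrA -invfM -exprS; congr (_ * _).
rewrite sum_ffun_recl; apply: eq_bigr => j _; apply: eq_bigr => f _.
rewrite big_ord_recl ffunE unlift_none/=; congr (p (_ + _)).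
by apply: eq_bigr => k _; rewrite ffunE liftK.
Qed.

End squares.

(** * The limit laws *)

Section unity_laws.
Variable R : realType.
Local Notation plane := (borel (Cplane R)).
Local Open Scope classical_set_scope.

Lemma square_expi (t : R) : square 1 (expi t).
Proof.
apply: norm_le_square; rewrite /expi normc_def/= cos2Dsin2 sqrtr1.
exact: lexx.
Qed.

Lemma unity_law_square (m : Nstar) : unity_law R m (~` square 1) = 0%E.
Proof.
case: m => [k|] /=.
  apply: empirical_full; first exact: measurable_square.
  by move=> _ /mapP[j _ ->]; exact: square_expi.
rewrite /distribution /pushforward (_ : _ @^-1` _ = set0) ?measure0//.
by apply/seteqP; split => // t /=; apply; exact: square_expi.
Qed.

Lemma unity_law_finite_mean (k : Npos) D p : real_zpoly D p ->
  \int[unity_law R (Some k)]_z p z =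
  (sval k)%:R^-1 * \sum_(j < sval k) p (unity_root R j).
Proof.
move=> pP; rewrite /= Rintegral_empirical; last exact: real_zpoly_measurable pP.
rewrite size_map size_iota big_map; congr (_ * _).
by rewrite (iotaDl 1 0) big_map -[X in iota 0 X]subn0 big_mkord.
Qed.

(* Encodes that [c] is the mean of the continuous function [g] over a period, by
   an explicit antiderivative. *)
Let periodic_mean (g : R -> R) (c : R) := continuous g /\
  exists2 F : R -> R, (forall t : R, is_derive t (1 : R) F (g t)) &
    F (2 * pi) - F 0 = 2 * pi * c.

Let periodic_meanD g h a b : periodic_mean g a -> periodic_mean h b ->
  periodic_mean (g \+ h) (a + b).
Proof.
move=> [cg [F dF FE]] [ch [H dH HE]]; split.
  by move=> t; apply: cvgD; [exact: cg|exact: ch].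
exists (F \+ H) => [t|]; first by have := dF t; have := dH t; move=> *; exact: is_deriveD.
by rewrite [RHS]mulrDr -FE -HE /=; ring.
Qed.

Let is_derive_scale (k t : R) : is_derive t (1 : R) (fun u : R => k * u) k.
Proof.
have h := is_deriveZ k (is_derive_id t (1 : R)).
by apply: (is_derive_eq h); exact: mulr1.
Qed.

Let periodic_mean_cst (c : R) : periodic_mean (fun=> c) c.
Proof.
split; first by move=> t; exact: cvg_cst.
exists (fun t => c * t) => [t|]; first exact: is_derive_scale.
by rewrite mulr0 subr0 mulrC.
Qed.

Let expi_int (k : int) : (expi (2 * pi * k%:~R : R) : R[i]) = 1.
Proof.
case: k => n; first by rewrite expi_natmul expi_2pi expr1n.
by rewrite NegzE mulrNz mulrN -expi_conj expi_natmul expi_2pi expr1n conjC1.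
Qed.

Let periodic_mean_trig (a b : R) (k : int) : k != 0 ->
  periodic_mean (fun t => a * cos (k%:~R * t) - b * sin (k%:~R * t)) 0.
Proof.
move=> k0; have k0' : k%:~R != 0 :> R by rewrite intr_eq0.
have cscale : continuous (fun t : R => k%:~R * t) by exact: mulrl_continuous.
split.
  move=> t; apply: cvgB; apply: cvgM; try exact: cvg_cst.
    exact: (continuous_comp (cscale t) (@continuous_cos _ _)).
  exact: (continuous_comp (cscale t) (@continuous_sin _ _)).
exists (fun t => a / k%:~R * sin (k%:~R * t) + b / k%:~R * cos (k%:~R * t)) => [t|].
  have dsin := is_derive1_comp (is_derive_sin _) (is_derive_scale k%:~R t).
  have dcos := is_derive1_comp (is_derive_cos _) (is_derive_scale k%:~R t).
  have h := is_deriveD (is_deriveZ (a / k%:~R) dsin) (is_deriveZ (b / k%:~R) dcos).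
  apply: (is_derive_eq h); rewrite -[_ *: _]/(_ * _) -[(b / _) *: _]/(_ * _).
  by field.
have := expi_int k; rewrite /expi mulrC => -[-> ->].
by rewrite !mulr0 sin0 cos0; ring.
Qed.

Let expi_monom (t : R) a b :
  (expi t : R[i]) ^+ a * ((expi t : R[i])^*)%R ^+ b = expi ((a%:Z - b%:Z)%:~R * t).
Proof.
rewrite expi_conj -!expi_natmul -expiD; congr expi.
by rewrite intrB mulrBl mulNr !(mulrC t).
Qed.

Let monom_mean (c : R[i]) a b :
  periodic_mean
    (fun t => complex.Re (c * (expi t : R[i]) ^+ a * ((expi t : R[i])^*)%R ^+ b))
    (complex.Re (c * (a == b)%:R)).
Proof.
under eq_fun do rewrite -mulrA expi_monom.
case: eqVneq => [->|ab].
  under eq_fun do rewrite subrr mul0r expi0; rewrite mulr1.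
  exact: periodic_mean_cst.
rewrite mulr0; have k0 : (a%:Z - b%:Z) != 0 by rewrite subr_eq0.
have := periodic_mean_trig (complex.Re c) (complex.Im c) k0.
by congr periodic_mean; apply/funext => t; case: (c).
Qed.

(* On the circle a monomial is the exponential of frequency [a - b], and
   [M > D >= a + b] divides [a - b] only when [a = b]: the mean over the [M]-th
   roots of unity keeps the same monomials as the mean over the circle. *)
Let real_zpoly_periodic D M p : (D < M)%N -> real_zpoly D p ->
  periodic_mean (fun t => p (expi t)) (M%:R^-1 * \sum_(j < M) p (unity_root R j)).
Proof.
move=> DM [s sD pE].
have pRe z : p z = \sum_(t <- s) complex.Re (t.1 * z ^+ t.2.1 * (z^*)%R ^+ t.2.2).
  by rewrite -raddf_sum -pE.
have M_gt0 : (0 < M)%N by exact: leq_ltn_trans DM.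
have -> : M%:R^-1 * \sum_(j < M) p (unity_root R j) =
    \sum_(t <- s) complex.Re (t.1 * (t.2.1 == t.2.2)%:R).
  under eq_bigr do rewrite pRe.
  rewrite exchange_big mulr_sumr; apply: eq_big_seq => t ts.
  rewrite -raddf_sum; under eq_bigr do rewrite -mulrA.
  rewrite -mulr_sumr sum_unity_root_monom//.
  have -> : (M %| `|t.2.1%:Z - t.2.2%:Z|)%N = (t.2.1 == t.2.2).
    have /= tD := allP sD t ts; apply/idP/eqP => [Mt|->]; last by rewrite subrr dvdn0.
    apply/eqP; rewrite -eqz_nat -subr_eq0 -absz_eq0; apply: contraLR Mt => t0.
    by rewrite gtnNdvd ?lt0n//; lia.
  case: (t.1) => x y; case: eqP => _; rewrite ?mulr0 ?mulr1/= ?mulr0 //.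
  have -> : (x +i* y)%C * M%:R = ((x * M%:R) +i* (y * M%:R))%C.
    rewrite -(rmorph_nat (real_complex R) M).
    by apply/eqP; rewrite eq_complex/= !mulr0 subr0 add0r !eqxx.
  by rewrite /= mulrCA mulVf ?mulr1// pnatr_eq0 -lt0n.
under eq_fun do rewrite pRe.
elim: s {sD pE pRe} => [|t s IH].
  by under eq_fun do rewrite big_nil; rewrite big_nil; exact: periodic_mean_cst.
rewrite big_cons; under eq_fun do rewrite big_cons.
by apply: periodic_meanD => //; exact: monom_mean.
Qed.

(** Adding the bound [B] makes the integrand nonnegative, so that integrals
    against the uniform law reduce to Lebesgue integrals. *)
Lemma unity_law_infinite_mean D M p : (D < M)%N -> real_zpoly D p ->
  \int[unity_law R None]_z p z = M%:R^-1 * \sum_(j < M) p (unity_root R j).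
Proof.
move=> DM pP; set c := (RHS).
have mp := real_zpoly_measurable pP.
have [B pB] := real_zpoly_bounded 1 pP.
pose g (t : measurableTypeR R) : R := p (expi t).
have mg : measurable_fun setT g by apply: measurableT_comp => //; exact: measurable_expi.
have gB t : `|g t| <= B by apply: pB; exact: square_expi.
have intg : (uniform_prob (twopi_gt0 R)).-integrable setT (EFin \o g).
  apply: (@integrable_concentrated _ _ _ _ setT) => //.
    by rewrite setCT measure0.
  by exists B.
rewrite /= /Rintegral integral_distribution//; last first.
  exact/measurable_EFinP.
have [cg [F dF FE]] := periodic_meanD (real_zpoly_periodic DM pP) (periodic_mean_cst B).
have intB : (\int[uniform_prob (twopi_gt0 R)]_t (g t + B)%:E = (c + B)%:E)%E.
  rewrite integral_uniform; last 2 first.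
  - by apply/measurable_EFinP; exact: measurable_funD.
  - by move=> t; rewrite lee_fin; have := gB t; rewrite ler_norml => /andP[]; lra.
  have cF : continuous F.
    by move=> t; apply: differentiable_continuous; apply/derivable1_diffP; have [] := dF t.
  rewrite (@continuous_FTC2 _ (fun t => g t + B) F).
  - rewrite -EFinB FE -EFinM subr0 mulKf//; exact/lt0r_neq0/twopi_gt0.
  - exact: twopi_gt0.
  - by apply: continuous_subspaceT => t; exact: cg.
  - split; first by move=> t _; have [] := dF t.
      exact/cvg_at_right_filter/cF.
    exact/cvg_at_left_filter/cF.
  - by move=> t _; rewrite derive1E; have [_] := dF t.
have intcB : (uniform_prob (twopi_gt0 R)).-integrable setT (EFin \o (fun=> B)).
  apply: (@integrable_concentrated _ _ _ _ setT) => //.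
    by rewrite setCT measure0.
  by exists `|B|.
have := congr1 fine intB; rewrite -[LHS]/(\int[uniform_prob (twopi_gt0 R)]_t (g t + B)).
rewrite RintegralD// Rintegral_cst//= probability_setT mulr1 => /addIr <-.
by [].
Qed.

End unity_laws.

(** * Convergence of the law of the order of a random element *)

Section order_laws.
Variable R : realType.
Local Open Scope classical_set_scope.
Implicit Types (f : Nstar -> R).

Lemma continuous_borel (T : ptopologicalType) (g : T -> R) : continuous g ->
  measurable_fun setT (g : g_sigma_algebraType (@open T) -> R).
Proof.
move=> /continuousP cg; apply: (measurability _ (RGenOpens.measurableE R)).
move=> _ [_ [a [b ->] <-]]; rewrite setTI; apply: sub_sigma_algebra.
exact/cg/interval_open.
Qed.

Lemma Rintegral_order_law (G : finZmodType) f : continuous f ->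
  \int[order_law R G]_z f z =
  #|G|%:R^-1 * \sum_(x : G) f (Some (pos_order x)).
Proof.
move=> cf; rewrite Rintegral_empirical; last exact: continuous_borel.
by rewrite size_map -cardE big_map big_enum.
Qed.

Lemma Rintegral_dirac_Nstar (m : Nstar) f : continuous f ->
  \int[dirac (m : borel Nstar)]_z f z = f m.
Proof.
move=> cf; rewrite /Rintegral integral_dirac// ?diracT ?mul1e//.
by apply/measurable_EFinP; exact: continuous_borel.
Qed.

(** Compact subsets of a discrete space are finite, so the neighbourhoods of the
    point at infinity contain all large integers. *)
Lemma continuous_Nstar_None f e : continuous f -> 0 < e ->
  exists n, forall k : Npos, (n < val k)%N -> `|f (Some k) - f None| < e.
Proof.
move=> cf e0; have [W [cW _] WP] : nbhs (None : Nstar) (f @^-1` ball (f None) e).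
  exact: (cf None _ (nbhsx_ballx (f None) _ e0)).
have [n _ nW] : \forall n \near \oo, W `<=` (fun k : discrete_topology Npos => (val k <= n)%N).
  have /compact_near_coveringP := cW; apply => x Wx.
  exists ([set x], [set n | (val x <= n)%N]) => /=.
    by split; [rewrite nbhs_principalE | exists (val x)].
  by move=> [y n] [/= -> ].
exists n => k kn; have := WP (Some k); rewrite /ball/= distrC; apply; left.
exists k => // Wk; have := nW n (leqnn n) k Wk; rewrite leqNgt kn.
by [].
Qed.

Lemma cvg_sum_to0 (I : Type) (r : seq I) (Q : pred I) (u : I -> nat -> R) :
  (forall i, Q i -> u i n @[n --> \oo] --> (0 : R)) ->
  \sum_(i <- r | Q i) u i n @[n --> \oo] --> (0 : R).
Proof.
move=> u0; elim: r => [|i r IH].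
  by under eq_fun do rewrite big_nil; exact: cvg_cst.
under eq_fun do rewrite big_cons; case: (boolP (Q i)) => // /u0 ui.
by have h := cvgD ui IH; rewrite addr0 in h; exact: h.
Qed.

Definition indic_order (k : Npos) : Nstar -> R := fun m => (m == Some k)%:R.

Lemma continuous_indic_order k : continuous (indic_order k).
Proof.
case=> [x|] A /nbhs_singleton Ax.
  change (nbhs (x : discrete_topology Npos) (Some @^-1` (indic_order k @^-1` A))).
  by apply: (filterS _ (discrete_set1 (x : discrete_topology Npos))) => y ->.
exists [set k : discrete_topology Npos].
  by split; [exact: compact_set1|exact: discrete_closed].
move=> y [[z zk <-]|->]; last exact: Ax.
rewrite /= /indic_order (_ : (Some z == Some k :> Nstar) = false); first exact: Ax.
by apply/eqP => -[zk']; apply: zk.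
Qed.

Definition order_freq (G : finZmodType) (k : nat) : R :=
  #|[pred x : G | #[x]%g == k]|%:R / #|G|%:R.

Definition tors_freq (G : finZmodType) (a : nat) : R :=
  #|tors G a|%:R / #|G|%:R.

Lemma Rintegral_indic_order (G : finZmodType) (k : Npos) :
  \int[order_law R G]_z indic_order k z = order_freq G (val k).
Proof.
rewrite Rintegral_order_law; last exact: continuous_indic_order.
rewrite mulrC /order_freq; congr (_ / _).
rewrite -sum1_card natr_sum [in RHS]big_mkcond/=.
apply: eq_bigr => x _; rewrite /indic_order inE.
rewrite (_ : (Some (pos_order x) == Some k :> Nstar) = (#[x]%g == val k)).
  by case: eqP.
by apply/eqP/eqP => [[<-]//|xk]; congr Some; apply/val_inj.
Qed.

Lemma tors_freq_sum (G : finZmodType) a : (0 < a)%N ->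
  tors_freq G a = \sum_(j < a.+1 | (0 < j)%N && (j %| a)%N) order_freq G j.
Proof.
move=> a0; rewrite /order_freq -mulr_suml; congr (_ / _).
rewrite -natr_sum; congr (_%:R); rewrite -sum1_card.
rewrite (partition_big (fun x : G => inord #[x]%g : 'I_a.+1)
  (fun j : 'I_a.+1 => (0 < j)%N && (j %| a)%N))/=; last first.
  move=> x; rewrite tors_order => xa.
  have xle : (#[x]%g < a.+1)%N by rewrite ltnS; exact: dvdn_leq.
  by rewrite (inordK xle) order_gt0 xa.
apply: eq_bigr => j /andP[j0 ja]; rewrite sum1_card; apply: eq_card => x.
rewrite [LHS]inE [RHS]inE /= -[x \in tors G a]/(x \in tors G a).
apply/andP/eqP => [[xa /eqP <-]|xj].
  have xle : (#[x]%g < a.+1)%N by rewrite ltnS dvdn_leq// -tors_order.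
  by rewrite (inordK xle).
by rewrite tors_order xj ja inord_val.
Qed.

Definition dvdNstar (m : Nstar) (a : nat) : bool :=
  if m is Some k then (val (k : Npos) %| a)%N else a == 0%N.

(** The arithmetic content of the weak convergence of the order laws to the Dirac
    mass at [m]: the density of the [a]-torsion tends to 0, unless [m] divides [a]
    and then the whole group is eventually [a]-torsion. *)
Definition order_limit (G : nat -> finZmodType) (m : Nstar) := forall a,
  if dvdNstar m a then \forall n \near \oo, forall x : G n, x *+ a = 0
  else tors_freq (G n) a @[n --> \oo] --> (0 : R).

Variable G : nat -> finZmodType.

(** Singletons of integers are clopen, so the proportion of elements of each
    finite order converges. When [m] is finite, more than half of the elements
    eventually have order [m], which forces the torsion subgroup of exponent [m]
    to be everything. *)
Lemma order_limit_of_weak_cvg m :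
  weak_cvg (fun n => order_law R (G n)) (dirac (m : borel Nstar)) ->
  order_limit G m.
Proof.
move=> cvg_m; have freq (k : Npos) :
    order_freq (G n) (val k) @[n --> \oo] --> ((m == Some k)%:R : R).
  have bnd : bounded_fun (indic_order k).
    exists 1; split; first exact: num_real.
    move=> B B1 z _; rewrite /= /indic_order ger0_norm// (le_trans _ (ltW B1))//.
    by rewrite lern1 leq_b1.
  have := cvg_m _ (@continuous_indic_order k) bnd.
  rewrite Rintegral_dirac_Nstar; last exact: continuous_indic_order.
  by under eq_fun do rewrite Rintegral_indic_order.
move=> a; case: ifP => [ma|/negbT ma]; last first.
  have a0 : (0 < a)%N.
    by rewrite lt0n; apply: contra ma => /eqP ->; case: m {cvg_m freq} => //= k; rewrite dvdn0.
  under eq_fun do rewrite tors_freq_sum//.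
  apply: cvg_sum_to0 => j /andP[j0 ja].
  have := freq (exist _ (j : nat) j0); rewrite (_ : (m == _) = false)//.
  by apply: contraNF ma => /eqP ->.
case: m ma {cvg_m} freq => [k ka freq|/eqP -> _]; last by near=> n => x; rewrite mulr0n.
have := freq k; rewrite eqxx => /cvgrPdist_lt/(_ 2^-1); rewrite invr_gt0 => /(_ (ltr0Sn _ 1)).
apply: filterS => n close x; move: ka => /= /dvdnP[q ->]; rewrite mulnC mulrnA.
rewrite (tors_full _ x) ?mul0rn//.
have N0 : 0 < #|G n|%:R :> R by rewrite ltr0n card_finZmod_gt0.
have [//|half] := card_tors_index (G n) (val k).
have : order_freq (G n) (val k) <= 2^-1.
  rewrite ler_pdivrMr// mulrC ler_pdivlMr// -natrM ler_nat mulnC.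
  apply: leq_trans half; rewrite leq_mul2l; apply/subset_leq_card/fintype.subsetP => y.
  by rewrite inE => /eqP yk; rewrite tors_order yk.
move=> le2; exfalso; move: close le2; rewrite ltr_norml /= => /andP[_].
by clear; lra.
Unshelve. all: by end_near. Qed.

(** Up to [e / 2], a continuous function takes the value [f m] at all orders but
    finitely many ones that are not multiples of [m], and these orders are
    asymptotically negligible. *)
Lemma weak_cvg_of_order_limit m : order_limit G m ->
  weak_cvg (fun n => order_law R (G n)) (dirac (m : borel Nstar)).
Proof.
move=> lim_m f cf [B0 [_ fB0]].
pose B := `|B0| + 1.
have fB z : `|f z| <= B.
  by apply: fB0 => //; rewrite (le_lt_trans (ler_norm _))// ltrDl.
rewrite Rintegral_dirac_Nstar//; apply/cvgrPdist_le => e e0.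
have e2 : 0 < e / 2 by rewrite divr_gt0.
have [J JP] : exists J, \forall n \near \oo, forall x : G n,
    `|f m - f (Some (pos_order x))| <= e / 2 \/
    (#[x]%g <= J)%N /\ ~~ dvdNstar m #[x]%g.
  case: m lim_m => [k|] lim_m.
    exists (val k); have := lim_m (val k); rewrite /= dvdnn.
    apply: filterS => n kill x.
    have xk : (#[x]%g %| val k)%N by rewrite -tors_order inE kill.
    have [xE|xk'] := eqVneq #[x]%g (val k).
      left; rewrite (_ : Some (pos_order x) = Some k) ?subrr ?normr0 ?ltW//.
      by congr Some; apply/val_inj.
    right; split; first by rewrite dvdn_leq// (valP k).
    apply: contra xk' => kx; rewrite eqn_leq (dvdn_leq (valP k) xk).
    exact: dvdn_leq (order_gt0 x) kx.
  have [J JP] := continuous_Nstar_None cf e2.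
  exists J; near=> n => x; have [xJ|Jx] := leqP #[x]%g J.
    by right; split=> //; rewrite /= -lt0n order_gt0.
  by left; rewrite distrC ltW// JP.
have tail : 2 * B * \sum_(j < J.+1 | ~~ dvdNstar m j) tors_freq (G n) j
    @[n --> \oo] --> (0 : R).
  rewrite -[X in _ --> X](mulr0 (2 * B)); apply: cvgMr.
  by apply: cvg_sum_to0 => j mj; have := lim_m j; rewrite (negPf mj).
have tail_le : \forall n \near \oo,
    2 * B * \sum_(j < J.+1 | ~~ dvdNstar m j) tors_freq (G n) j <= e / 2.
  move/cvgrPdist_le : tail => /(_ _ e2); apply: filterS => n.
  by rewrite sub0r normrN => /(le_trans (ler_norm _)).
apply: filterS2 JP tail_le => n JPn tail_n.
have N0 : 0 < #|G n|%:R :> R by rewrite ltr0n card_finZmod_gt0.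
rewrite Rintegral_order_law//.
have -> : f m = #|G n|%:R^-1 * \sum_(x : G n) f m.
  by rewrite sumr_const -[f m *+ _]mulr_natl mulKf// gt_eqF.
rewrite -mulrBr -sumrB normrM ger0_norm ?invr_ge0 ?ler0n//.
rewrite [leLHS]mulrC ler_pdivrMr//.
apply: le_trans (ler_norm_sum _ _ _) _.
have pt (x : G n) : `|f m - f (Some (pos_order x))| <=
    e / 2 + \sum_(j < J.+1 | ~~ dvdNstar m j) 2 * B * (x \in tors (G n) j)%:R.
  have B0' : 0 <= B by rewrite addr_ge0.
  have [close|[xJ xm]] := JPn x.
    rewrite (le_trans close)// lerDl sumr_ge0// => j _.
    by rewrite !mulr_ge0.
  apply: ler_wpDl; first exact: ltW.
  have xJ' : (#[x]%g < J.+1)%N by [].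
  rewrite (bigD1 (Ordinal xJ'))//= tors_order dvdnn mulr1.
  apply: ler_wpDr; first by rewrite sumr_ge0// => j _; rewrite !mulr_ge0.
  by apply: le_trans (ler_normB _ _) _; rewrite mulr2n mulrDl !mul1r lerD.
apply: le_trans (ler_sum _ (fun x _ => pt x)) _.
rewrite big_split/= sumr_const -[e / 2 *+ _]mulr_natl.
rewrite exchange_big/=; under eq_bigr do rewrite -mulr_sumr.
rewrite -mulr_sumr.
have -> : \sum_(j < J.+1 | ~~ dvdNstar m j) \sum_(x : G n) (x \in tors (G n) j)%:R =
    (\sum_(j < J.+1 | ~~ dvdNstar m j) tors_freq (G n) j) * #|G n|%:R :> R.
  rewrite mulr_suml; apply: eq_bigr => j _; rewrite divfK ?gt_eqF//.
  by rewrite -natr_sum -sum1_card [in RHS]big_mkcond.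
rewrite [_%:R * (e / 2)]mulrC mulrA -mulrDl ler_wpM2r//.
by move: tail_n; clear; lra.
Unshelve. all: by end_near. Qed.

End order_laws.

(** * Coincidence counts along a sequence of groups *)

Section limits_in_probability.
Variables (R : realType) (G : nat -> finZmodType) (d : nat).
Local Open Scope classical_set_scope.
Hypothesis G_infty : (fun n => #|G n|) @ \oo --> \oo.

Let N_gt0 n : 0 < #|G n|%:R :> R.
Proof. by rewrite ltr0n card_finZmod_gt0. Qed.

Lemma card_group_ge K : \forall n \near \oo, (K <= #|G n|)%N.
Proof. exact: G_infty (nbhs_infty_ge K). Qed.

Lemma cvg_inv_card c : c / #|G n|%:R @[n --> \oo] --> (0 : R).
Proof.
apply/cvgrPdist_le => e e0.
apply: filterS (card_group_ge (Num.truncn (`|c| / e)).+1) => n nK.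
rewrite sub0r normrN normrM normfV [X in _ / X]ger0_norm ?ler0n//.
rewrite ler_pdivrMr// -ler_pdivrMl// mulrC.
by apply: le_trans (ltW (truncnS_gt _)) _; rewrite ler_nat.
Qed.

Definition coinc_neq_freq (a b c n : nat) : R :=
  #|[pred x : {ffun 'I_d -> G n} | coinc a b x != c]|%:R / #|G n|%:R ^+ d.

(** A matched pair of words has equal sums on all tuples, eventually. An unmatched
    one has a letter whose counts differ by some [k] that [M] does not divide,
    and its sums agree with probability at most the density of the
    [k]-torsion. *)
Lemma coinc_neq_freq_cvg0 (m : Nstar) M a b : order_limit R G m ->
  (forall k, (k <= a + b)%N -> dvdNstar m k = (M %| k)%N) ->
  coinc_neq_freq a b (coinc_lim d M a b) n @[n --> \oo] --> (0 : R).
Proof.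
move=> lim_m mM.
pose u (fg : {ffun 'I_a -> 'I_d} * {ffun 'I_b -> 'I_d}) n : R :=
  #|[pred x : {ffun 'I_d -> G n} |
        (x \in lin_ker (G n) (occB fg.1 fg.2)) != words_match M fg]|%:R / #|G n|%:R ^+ d.
have u0 fg : u fg n @[n --> \oo] --> (0 : R).
  have [fgM|fgM] := boolP (words_match M fg).
    have kill : \forall n \near \oo, forall k : 'I_(a + b).+1, (M %| k)%N ->
        forall x : G n, x *+ k = 0.
      apply: filter_forall => k; have [Mk|Mk] := boolP (M %| k)%N; last by near=> n.
      have := lim_m k; rewrite mM ?Mk; last by rewrite -ltnS.
      by apply: filterS => n kill_k.
    apply: cvg_near_cst; apply: filterS kill => n kill.
    rewrite /u card_exceptions_matched// ?mul0r// => k kab Mk.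
    exact: (kill (Ordinal (kab : (k < (a + b).+1)%N))).
  have kP n : exists2 k, ((k <= a + b)%N && ~~ (M %| k)%N) & u fg n <= tors_freq R (G n) k.
    have [j jab cnt] := card_exceptions_unmatched (G n) fgM; exists j => //.
    rewrite /u /tors_freq ler_pdivrMr ?exprn_gt0// mulrAC ler_pdivlMr//.
    by rewrite -natrX -!natrM ler_nat mulnC [X in (_ <= X)%N]mulnC mulnC.
  have tail : \sum_(k < (a + b).+1 | ~~ (M %| k)%N) tors_freq R (G n) k
      @[n --> \oo] --> (0 : R).
    apply: cvg_sum_to0 => k' k'M; have := lim_m k'.
    by rewrite mM ?(negPf k'M)// -ltnS.
  apply: (squeeze_cvgr _ (cvg_cst 0) tail); near=> n.
  rewrite /u divr_ge0 ?exprn_ge0//=; have [j /andP[jab jM]] := kP n.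
  move=> /le_trans; apply; rewrite (bigD1 (Ordinal (jab : (j < (a + b).+1)%N)))//=.
  by rewrite lerDl sumr_ge0// => i _; rewrite divr_ge0.
apply: (squeeze_cvgr _ (cvg_cst 0) (cvg_sum_to0 (index_enum _) (fun fg (_ : xpredT fg) => u0 fg))).
near=> n; rewrite divr_ge0 ?exprn_ge0//=.
rewrite -mulr_suml ler_wpM2r ?invr_ge0 ?exprn_ge0// -natr_sum ler_nat.
exact: card_coinc_neq_lim.
Unshelve. all: by end_near. Qed.

(** When the count of zero-sum words concentrates at [c = 0], torsion tuples are
    rare because their count is positive; when [c > 0], the group is eventually
    [k]-torsion by [tors_full_of_coinc]. *)
Lemma tors_limit_of_coinc k c : (0 < d)%N ->
  coinc_neq_freq k 0 c n @[n --> \oo] --> (0 : R) ->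
  (\forall n \near \oo, forall x : G n, x *+ k = 0) \/
  tors_freq R (G n) k @[n --> \oo] --> (0 : R).
Proof.
move=> d_gt0 bad0; have [c0|c_gt0] := posnP c.
  right; apply/cvgrPdist_lt => e e0.
  have /cvgrPdist_lt/(_ (e ^+ d)) := bad0; rewrite exprn_gt0// => /(_ isT).
  apply: filterS => n; rewrite !sub0r !normrN.
  rewrite !ger0_norm ?divr_ge0 ?exprn_ge0// => bad_lt.
  rewrite -(@ltr_pXn2r _ d) ?nnegrE ?divr_ge0 ?(ltW e0)//.
  apply: le_lt_trans bad_lt; rewrite expr_div_n ler_wpM2r ?invr_ge0 ?exprn_ge0//.
  by rewrite -natrX ler_nat c0 card_tors_le_coinc_neq0.
left; pose K := ((2 * d ^ k) ^ d * (4 * d ^ k))%N.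
have /cvgrPdist_lt/(_ (K%:R + 1)^-1) := bad0.
rewrite invr_gt0 ltr_wpDl// => /(_ isT); apply: filterS => n.
rewrite sub0r normrN ger0_norm ?divr_ge0 ?exprn_ge0// => bad_lt x.
apply: tors_full; apply: (tors_full_of_coinc d_gt0 c_gt0).
rewrite -/K -(ltr_nat R) natrM natrX.
move: bad_lt; rewrite /coinc_neq_freq ltr_pdivrMr ?exprn_gt0// mulrC ltr_pdivlMr ?ltr_wpDl//.
apply: le_lt_trans; rewrite mulrDr mulr1 mulrC lerDl.
by [].
Qed.

End limits_in_probability.

Section spectral_integrals.
Variables (R : realType) (d : nat) (G : finZmodType).
Implicit Types (x : {ffun 'I_d -> G}).
Local Open Scope classical_set_scope.

Local Notation esd_circ x := (esd (card_finZmod_gt0 G) (circmx R x)).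

Lemma esd_circmx_square x : esd_circ x (~` square d%:R) = 0%E.
Proof.
apply: empirical_full; first exact: measurable_square.
move=> z /circmx_eigenvalue_le; rewrite -(rmorph_nat (real_complex R)).
exact: norm_le_square.
Qed.

(** The function need only agree with a polynomial on the spectrum, which allows
    truncated monomials as bounded test functions. *)
Lemma Rintegral_esd_circmx x (s : seq (R[i] * (nat * nat))) (p : Cplane R -> R) :
  measurable_fun setT (p : borel (Cplane R) -> R) ->
  (forall z : Cplane R, z \in eigenvalues (circmx R x) ->
    p z = complex.Re (\sum_(t <- s) t.1 * (z : R[i]) ^+ t.2.1 * ((z : R[i])^*)%R ^+ t.2.2)) ->
  \int[esd_circ x]_z p z =
  complex.Re (\sum_(t <- s) t.1 * (coinc t.2.1 t.2.2 x)%:R).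
Proof.
move=> mp pE; rewrite /esd Rintegral_empirical//.
rewrite size_eigenvalues (eq_big_seq _ pE) -raddf_sum exchange_big/=.
have N0 : #|G|%:R != 0 :> R[i] by rewrite pnatr_eq0 -lt0n card_finZmod_gt0.
have -> : \sum_(t <- s) \sum_(z <- eigenvalues (circmx R x))
    t.1 * (z : R[i]) ^+ t.2.1 * ((z : R[i])^*)%R ^+ t.2.2 =
    #|G|%:R * \sum_(t <- s) t.1 * (coinc t.2.1 t.2.2 x)%:R.
  rewrite mulr_sumr; apply: eq_bigr => t _; under eq_bigr do rewrite -mulrA.
  by rewrite -mulr_sumr circmx_moment mulrCA.
case: (\sum_(t <- s) _) => a b.
rewrite -(rmorph_nat (real_complex R)) /= mul0r subr0 mulKf// pnatr_eq0 -lt0n.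
exact: card_finZmod_gt0.
Qed.

End spectral_integrals.

(** * Convergence in probability of the spectral distributions *)

Section transfer.
Variables (R : realType) (d : nat) (G : nat -> finZmodType).
Local Open Scope classical_set_scope.
Hypothesis d_gt0 : (0 < d)%N.
Hypothesis G_infty : (fun n => #|G n|) @ \oo --> \oo.
Variables (disp : nat -> measure_display) (Omega : forall n, measurableType (disp n)).
Variables (P : forall n, probability (Omega n) R)
  (C : forall n, Omega n -> 'M[R[i]]_#|G n|).
Hypothesis C_uniform : forall n, (d <= #|G n|)%N ->
  uniformly_distributed (P n) (Mat R d (G n)) (@C n).

Let large : \forall n \near \oo, (2 * d ^ 2 <= #|G n|)%N /\ (d <= #|G n|)%N.
Proof.
near=> n; have dN : (2 * d ^ 2 <= #|G n|)%N by near: n; exact: card_group_ge.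
by split=> //; apply: leq_trans dN; rewrite expnS expn1; nia.
Unshelve. all: by end_near. Qed.

Lemma prob_cvg0P (Q : forall n, set 'M[R[i]]_#|G n|) :
  P n [set w | Q n (C w)] @[n --> \oo] --> (0 : \bar R) <->
  #|[pred x : {ffun 'I_d -> G n} | `[< Q n (circmx R x) >]]|%:R / #|G n|%:R ^+ d
    @[n --> \oo] --> (0 : R).
Proof.
split=> [P0|T0].
  have : fine (P n [set w | Q n (C w)]) + d%:R ^+ 2 / #|G n|%:R @[n --> \oo] --> (0 + 0 : R).
    by apply: cvgD; [exact: fine_cvg P0|exact: cvg_inv_card].
  rewrite addr0; apply: squeeze_cvgr (cvg_cst 0); apply: filterS large => n [_ dN].
  rewrite divr_ge0 ?exprn_ge0//= -lee_fin EFinD fineK ?fin_num_measure//.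
    exact: uniform_circulant_ge (C_uniform dN) _.
  exact: (uniform_circulant_prob (C_uniform dN) _).1.
have T0' : (2 * (#|[pred x : {ffun 'I_d -> G n} | `[< Q n (circmx R x) >]]|%:R /
    #|G n|%:R ^+ d))%:E @[n --> \oo] --> (0 : \bar R).
  apply: cvg_EFin; first by near=> n.
  rewrite -[X in _ --> X](mulr0 2); exact: cvgMr.
apply: (squeeze_cvge _ (cvg_cst 0%E) T0'); apply: filterS large => n [dN2 dN].
by rewrite measure_ge0/= (uniform_circulant_le (C_uniform dN)).
Unshelve. all: by end_near. Qed.

Let mu_C n (w : Omega n) := esd (card_finZmod_gt0 (G n)) (C w).

(** The real part of [z ^+ k], truncated at the bound [d ^ k] that it satisfies on
    the spectrum. *)
Lemma moment_integral_coinc k : exists2 f : Cplane R -> R, continuous f /\ bounded_fun f &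
  forall n (x : {ffun 'I_d -> G n}),
    \int[esd (card_finZmod_gt0 (G n)) (circmx R x)]_z f z = (coinc k 0 x)%:R.
Proof.
pose K : R := d%:R ^+ k.
have K0 : 0 <= K by rewrite exprn_ge0.
pose g (z : Cplane R) : R := complex.Re (z ^+ k).
pose f (z : Cplane R) : R := Num.max (- K) (Num.min K (g z)).
have cg : continuous g.
  suff [] : continuous (fun z : Cplane R => complex.Re (z ^+ k) : R) /\
    continuous (fun z : Cplane R => complex.Im (z ^+ k) : R) by [].
  elim: k {K K0 g f} => [|k [cRe cIm]].
    have cst (c : R) : continuous (fun _ : Cplane R => c) by exact: cst_continuous.
    by split; [exact: (cst 1)|exact: (cst 0)].
  have cM (g1 g2 : Cplane R -> R) : continuous g1 -> continuous g2 ->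
      continuous (fun z => g1 z * g2 z).
    by move=> c1 c2 z; exact: (@cvgM _ _ _ (nbhs_filter z) _ _ _ _ (c1 z) (c2 z)).
  have cD (g1 g2 : Cplane R -> R) : continuous g1 -> continuous g2 ->
      continuous (fun z => g1 z + g2 z).
    by move=> c1 c2 z; exact: (@cvgD _ R^o _ _ (nbhs_filter z) _ _ _ _ (c1 z) (c2 z)).
  have cN (g1 : Cplane R -> R) : continuous g1 -> continuous (fun z => - g1 z).
    by move=> c1 z; exact: (@cvgN _ R^o _ _ (nbhs_filter z) _ _ (c1 z)).
  have [cR cI] := (@Re_continuous R, @Im_continuous R).
  split.
    rewrite (_ : (fun _ => _) = fun z : Cplane R =>
        complex.Re z * complex.Re (z ^+ k) + - (complex.Im z * complex.Im (z ^+ k))).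
      by apply: cD; [exact: cM|apply: cN; exact: cM].
    by apply/funext => y; rewrite exprS; case: (y ^+ k) => ? ?; case: y.
  rewrite (_ : (fun _ => _) = fun z : Cplane R =>
      complex.Re z * complex.Im (z ^+ k) + complex.Im z * complex.Re (z ^+ k)).
    by apply: cD; exact: cM.
  by apply/funext => y; rewrite exprS; case: (y ^+ k) => ? ?; case: y.
have cf : continuous f.
  have cst (c : R) : continuous (fun _ : Cplane R => c) by exact: cst_continuous.
  have cmin z : {for z, continuous ((fun=> K) \min g)}.
    exact: (@continuous_min R _ (fun=> K) g z (cst K z) (cg z)).
  move=> z.
  exact: (@continuous_max R _ (fun=> - K) ((fun=> K) \min g) z (cst (- K) z) (cmin z)).
exists f.
  split=> //; exists K; split; first exact: num_real.
  move=> B KB z _; apply: le_trans (ltW KB); rewrite /f ler_norml.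
  by rewrite le_max lexx ge_max ge_min lexx/= ; lra.
move=> n x; rewrite (@Rintegral_esd_circmx R d (G n) x [:: (1, (k, 0%N))]).
- by rewrite big_seq1/= mul1r -(rmorph_nat (real_complex R)).
- exact: continuous_borel_measurable.
- move=> z /circmx_eigenvalue_le zd; rewrite big_seq1/= mul1r expr0 mulr1.
  have : `|g z| <= K.
    rewrite -lecR; apply: le_trans (_ : `|z ^+ k| <= _).
      by rewrite /g normc_def lecR -sqrtr_sqr ler_wsqrtr// lerDl sqr_ge0.
    rewrite normrX rmorphXn/= lerXn2r ?nnegrE//.
      by rewrite rmorph_nat.
    by rewrite rmorph_nat.
  rewrite ler_norml => /andP[g1 g2].
  by rewrite /f -/(g z) (min_idPr g2) (max_idPr g1).
Qed.

(** The integer [coinc k 0 x] converges in probability to a constant, which is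
    therefore within 1/4 of an integer [c], and the count equals [c] with
    probability tending to 1. So each [k] either eventually annihilates the groups
    or has negligible torsion, and the limit order is the least annihilating [k],
    infinite if there is none. *)
Lemma order_limit_of_spectral_limit (mu : probability (borel (Cplane R)) R) :
  weak_cvg_in_probability P mu_C mu -> exists m, order_limit R G m.
Proof.
move=> cvg_mu.
have dichotomy k : (\forall n \near \oo, forall x : G n, x *+ k = 0) \/
    tors_freq R (G n) k @[n --> \oo] --> (0 : R).
  have [f [cf bf] fE] := moment_integral_coinc k.
  set l := \int[mu]_z f z.
  have e0 : 0 < 4^-1 :> R by rewrite invr_gt0.
  have := cvg_mu f cf bf _ e0; rewrite -/l.
  move/(prob_cvg0P (fun n => [set A | 4^-1 < `|\int[esd (card_finZmod_gt0 (G n)) A]_z f z - l|])) => T0.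
  pose far n : {pred {ffun 'I_d -> G n}} := [pred x | 4^-1 < `|(coinc k 0 x)%:R - l|].
  have {}T0 : #|far n|%:R / #|G n|%:R ^+ d @[n --> \oo] --> (0 : R).
    apply: cvg_trans T0; apply: near_eq_cvg; near=> n; congr (_%:R / _).
    by apply: eq_card => x; rewrite !inE/= fE; apply/asboolP/idP.
  have N_gt0 n : 0 < #|G n|%:R :> R by rewrite ltr0n card_finZmod_gt0.
  have [c cl] : exists c : nat, `|c%:R - l| <= 4^-1.
    have /cvgrPdist_lt/(_ 1 ltr01) [n _ /(_ n (leqnn n))] := T0.
    rewrite sub0r normrN ger0_norm ?divr_ge0 ?exprn_ge0//.
    rewrite ltr_pdivrMr ?exprn_gt0// mul1r -natrX ltr_nat => few.
    have [x xl|all_far] := pickP (fun x : {ffun 'I_d -> G n} => `|(coinc k 0 x)%:R - l| <= 4^-1).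
      by exists (coinc k 0 x).
    exfalso; move: few; rewrite (_ : #|far n| = (#|G n| ^ d)%N) ?ltnn//.
    rewrite -[X in (_ ^ X)%N](card_ord d) -card_ffun; apply: eq_card => x.
    by rewrite !inE ltNge all_far.
  apply: (tors_limit_of_coinc (c := c) d_gt0).
  apply: (squeeze_cvgr _ (cvg_cst 0) T0); near=> n.
  rewrite /coinc_neq_freq divr_ge0 ?exprn_ge0//= ler_wpM2r ?invr_ge0 ?exprn_ge0// ler_nat.
  apply/subset_leq_card/fintype.subsetP => x; rewrite !inE.
  apply: contraNT; rewrite -leNgt => xl.
  have : `|(coinc k 0 x)%:R - c%:R| < 1 :> R.
    rewrite -(subrKA l) (le_lt_trans (ler_normD _ _))//.
    by move: xl cl; rewrite [X in _ -> X <= _ -> _]distrC; lra.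
  rewrite ltr_norml => /andP[h1 h2].
  have h1' : (c < (coinc k 0 x).+1)%N by rewrite -(ltr_nat R) -natr1; lra.
  have h2' : (coinc k 0 x < c.+1)%N by rewrite -(ltr_nat R) -natr1; lra.
  by rewrite eqn_leq -ltnS h2' -ltnS h1'.
pose kills k := `[< \forall n \near \oo, forall x : G n, x *+ k = 0 >].
have [[k /andP[k0 kk]]|nokill] := pselect (exists k, (0 < k)%N && kills k); last first.
  exists None => a; rewrite /=; case: eqP => [->|/eqP a0].
    by near=> n => x; rewrite mulr0n.
  have [ka|//] := dichotomy a; exfalso; apply: nokill; exists a.
  by rewrite lt0n a0; apply/asboolP.
have exk : exists k, (0 < k)%N && kills k by exists k; rewrite k0.
have [m0 /andP[m_gt0 /asboolP mk] m_min] := ex_minnP exk.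
exists (Some (exist _ m0 m_gt0)) => a /=; case: ifP => [/dvdnP[q ->]|/negbT ma].
  by apply: filterS mk => n mk x; rewrite mulnC mulrnA mk mul0rn.
have [ka|//] := dichotomy a; exfalso; move: ma; apply/negP; rewrite negbK.
(* if [a] also annihilates, so does its gcd with the least annihilator [m0] *)
have g0 : (0 < gcdn m0 a)%N by rewrite gcdn_gt0 m_gt0.
have : (m0 <= gcdn m0 a)%N.
  apply: m_min; rewrite g0; apply/asboolP; apply: filterS2 mk ka => n mk ka x.
  apply/eqP; rewrite -[_ == 0]/(x \in tors (G n) (gcdn m0 a)) tors_order dvdn_gcd.
  by rewrite -!tors_order !inE mk ka eqxx.
move=> mg; have /eqP <- : gcdn m0 a == m0 by rewrite eqn_leq mg dvdn_leq// dvdn_gcdl.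
exact: dvdn_gcdr.
Unshelve. all: by end_near. Qed.

(* For polynomials of degree at most [D], the circle may be replaced by the roots
   of unity of order [D.+1]. *)
Let roots_count (m : Nstar) D : nat := if m is Some k then val (k : Npos) else D.+1.

Let Rintegral_limit_law (m : Nstar) D p : real_zpoly D p ->
  \int[convolution_pow (unity_law R m) d]_z p z =
  (roots_count m D)%:R ^- d *
    \sum_(f : {ffun 'I_d -> 'I_(roots_count m D)}) p (\sum_k unity_root R (f k)).
Proof.
move=> pP.
apply: (@Rintegral_convolution_pow R _ (@unity_root R (roots_count m D)) _ D _ _ d p pP).
  exact: unity_law_square.
case: m => [k|] q qP; first exact: unity_law_finite_mean qP.
exact: unity_law_infinite_mean qP.
Qed.

(** Replace the test function by a polynomial [p] on the square that carries all
    spectra and the limit law. The integral of [p] is then a fixed linear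
    combination of coincidence counts, which take their limit values with
    probability tending to 1. *)
Lemma spectral_limit_of_order_limit m : order_limit R G m ->
  weak_cvg_in_probability P mu_C (convolution_pow (unity_law R m) d).
Proof.
move=> lim_m f cf [B0 [_ fB0]] eps eps0.
pose B := `|B0| + 1.
have fB z : `|f z| <= B by apply: fB0 => //; rewrite (le_lt_trans (ler_norm _))// ltrDl.
have e0 : 0 < eps / 3 by rewrite divr_gt0.
have d0 : 0 < d%:R :> R by rewrite ltr0n.
have [D [p pP fp]] := zpoly_approx cf fB d0 e0.
have [s sD pE] := pP; pose M := roots_count m D.
have M_gt0 : (0 < M)%N by rewrite /M; case: (m) => [k|] //=; exact: (valP k).
have mf : measurable_fun setT (f : borel (Cplane R) -> R) by exact: continuous_borel_measurable.
have mp := real_zpoly_measurable pP.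
pose c := complex.Re (\sum_(t <- s) t.1 * (coinc_lim d M t.2.1 t.2.2)%:R).
have pRe z : p z = complex.Re (\sum_(t <- s) t.1 * z ^+ t.2.1 * (z^*)%R ^+ t.2.2).
  by rewrite -pE.
have lim_p : \int[convolution_pow (unity_law R m) d]_z p z = c.
  rewrite (Rintegral_limit_law m pP) -/M.
  under eq_bigr do rewrite pRe.
  rewrite -raddf_sum exchange_big/=.
  have -> : \sum_(t <- s) \sum_(f : {ffun 'I_d -> 'I_M}) t.1 *
        (\sum_k unity_root R (f k)) ^+ t.2.1 * ((\sum_k unity_root R (f k))^*)%R ^+ t.2.2 =
      (M%:R ^+ d)%:C%C * \sum_(t <- s) t.1 * (coinc_lim d M t.2.1 t.2.2)%:R.
    rewrite mulr_sumr; apply: eq_bigr => t _; under eq_bigr do rewrite -mulrA.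
    by rewrite -mulr_sumr sum_ffun_unity_roots// mulrCA rmorphXn/= rmorph_nat.
  rewrite /c; case: (\sum_(t <- s) _) => u v /=.
  by rewrite mul0r subr0 mulKf// expf_neq0// pnatr_eq0 -lt0n.
have close (nu : probability (borel (Cplane R)) R) : nu (~` square d%:R) = 0%E ->
    `|\int[nu]_z f z - \int[nu]_z p z| <= eps / 3.
  move=> nu0; apply: (Rintegral_dist_le (measurable_square d%:R) nu0) => //.
  - by exists B.
  - exact: real_zpoly_bounded pP.
  - by move=> z [z1 z2]; exact: fp.
set l := \int[convolution_pow (unity_law R m) d]_z f z.
have lc : `|l - c| <= eps / 3.
  rewrite -lim_p; apply: close; apply: convolution_pow_square; exact: unity_law_square.
apply/(prob_cvg0P (fun n => [set A | eps < `|\int[esd (card_finZmod_gt0 (G n)) A]_z f z - l|])).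
have tail : \sum_(t <- s | (t.2.1 + t.2.2 <= D)%N)
    coinc_neq_freq R G d t.2.1 t.2.2 (coinc_lim d M t.2.1 t.2.2) n @[n --> \oo] --> (0 : R).
  apply: cvg_sum_to0 => t tD; apply: coinc_neq_freq_cvg0 lim_m _ => k kt.
  rewrite /M; case: (m) => [//|] /=; apply/eqP/idP => [->|]; first exact: dvdn0.
  apply: contraTeq => k0; rewrite gtnNdvd ?lt0n// ltnS.
  exact: leq_trans kt tD.
apply: (squeeze_cvgr _ (cvg_cst 0) tail); near=> n.
rewrite divr_ge0 ?exprn_ge0//= /coinc_neq_freq -mulr_suml.
rewrite ler_wpM2r ?invr_ge0 ?exprn_ge0// -natr_sum ler_nat.
under [leqRHS]eq_bigr do rewrite -sum1_card.
rewrite (exchange_big_dep predT)//= -sum1_card big_mkcond/=.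
apply: leq_sum => x _; case: ifP => //; rewrite inE => /asboolP /= far.
rewrite sum1_count -has_count; apply: contraPT far => /hasPn good.
suff le_eps : `|\int[esd (card_finZmod_gt0 (G n)) (circmx R x)]_z f z - l| <= eps.
  by move/asboolP; rewrite /= ltNge le_eps.
have := close _ (esd_circmx_square R x).
rewrite (Rintegral_esd_circmx (s := s) mp) => [|z _]; last exact: pRe.
rewrite (eq_big_seq (fun t => t.1 * (coinc_lim d M t.2.1 t.2.2)%:R)); last first.
  move=> t ts; have := good t ts; rewrite inE (allP sD t ts)/= negbK => /eqP ->.
  by [].
rewrite -/c => close_x; move: close_x lc.
rewrite !ler_norml => /andP[h1 h2] /andP[h3 h4].
by apply/andP; split; lra.
Unshelve. all: by end_near. Qed.

End transfer.

Local Open Scope classical_set_scope.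

Theorem theorem1p3 (R : realType) (d : nat) (d_gt0 : (0 < d)%N)
    (G : nat -> finZmodType)
    (G_infty : (fun n => #|G n|) @ \oo --> \oo)
    (disp : nat -> measure_display)
    (Omega : forall n, measurableType (disp n))
    (P : forall n, probability (Omega n) R)
    (C : forall n, Omega n -> 'M[R[i]]_#|G n|)
    (C_uniform : forall n, (d <= #|G n|)%N ->
       uniformly_distributed (P n) (Mat R d (G n)) (C n)) :
  let mu_C := fun n (w : Omega n) => esd (card_finZmod_gt0 (G n)) (C n w) in
  ((exists mu : probability (borel (Cplane R)) R,
      weak_cvg_in_probability P mu_C mu) ->
   exists m : Nstar, weak_cvg (fun n => order_law R (G n)) (dirac (m : borel Nstar))) /\
  (forall m : Nstar, weak_cvg (fun n => order_law R (G n)) (dirac (m : borel Nstar)) ->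
   weak_cvg_in_probability P mu_C (convolution_pow (unity_law R m) d)).
Proof.
move=> mu_C; split=> [[mu cvg_mu]|m cvg_m].
  have [m lim_m] := order_limit_of_spectral_limit d_gt0 G_infty C_uniform cvg_mu.
  by exists m; exact: weak_cvg_of_order_limit lim_m.
exact: (spectral_limit_of_order_limit d_gt0 G_infty C_uniform
  (order_limit_of_weak_cvg cvg_m)).
Qed.
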